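(* Let $G$ be a connected SVD-closed subgroup of $U_n$ with Lie algebra $\mathfrak{g}\subseteq\mathfrak{u}_n$. Then: (a) for every $M\in G$ the set $\mathfrak{g}\text{-}plog(M)$ is non-empty; furthermore, if $-1$ is not an eigenvalue of $M$, then $\mathfrak{g}\text{-}plog(M)$ consists of a single element; (b) if $M\in G$ and $Y\in\mathfrak{g}\text{-}plog(M)$, then $\|Y\|_\phi\le\|X\|_\phi$ for every $X\in\mathfrak{g}$ such that $\exp(X)=M$; moreover equality holds if and only if $X\in\mathfrak{g}\text{-}plog(M)$.
   Context: $U_n$ is the group of $n\times n$ complex unitary matrices, $\mathfrak{u}_n$ the real Lie algebra of $n\times n$ skew-hermitian matrices, and $\|A\|_\phi:=\sqrt{tr(AA^* )}$ is the Frobenius norm. SVD-closure: A non-empty family $A_1,\dots,A_p$ of non-zero matrices of $\mathfrak{gl}_n(\mathbb{C})$ is an SVD-system if $A_h^*A_j=A_hA_j^*=0$ for every $h\neq j$ and $A_jA_j^*A_j=A_j$ for every $j$. Every $M\in\mathfrak{gl}_n(\mathbb{C})\setminus\{0\}$ has a unique SVD-decomposition $M=\sum_{j=1}^p\sigma_jA_j$, where $A_1,\dots,A_p$ is an SVD-system and $\sigma_1>\dots>\sigma_p>0$; the $A_j$ are the SVD-components of $M$. A real Lie subalgebra $\mathfrak{g}$ of $\mathfrak{gl}_n(\mathbb{C})$ is SVD-closed if all SVD-components of every matrix of $\mathfrak{g}\setminus\{0\}$ belong to $\mathfrak{g}$. A subgroup of $GL_n(\mathbb{C})$ is SVD-closed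 if it is closed in $GL_n(\mathbb{C})$ and its Lie algebra is SVD-closed. Generalized principal logarithms: if $G$ is a connected closed subgroup of $GL_n(\mathbb{C})$ with Lie algebra $\mathfrak{g}$ and $M\in G$, then $\mathfrak{g}\text{-}plog(M)$ is the set of all $L\in\mathfrak{g}$ such that $\exp(L)=M$ and $-\pi\le Im(\lambda)\le\pi$ for every eigenvalue $\lambda$ of $L$. *)

(* Defs.v *)
From HB Require Import structures.
From mathcomp Require Import all_boot all_order all_algebra.
From mathcomp Require Import complex.
From mathcomp Require Import all_classical all_reals all_analysis.

Set Implicit Arguments.
Unset Strict Implicit.
Unset Printing Implicit Defensive.

Import Order.TTheory GRing.Theory Num.Theory.
Import numFieldNormedType.Exports.

Local Open Scope classical_set_scope.
Local Open Scope ring_scope.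
Local Open Scope sesquilinear_scope.

(* The field of complex numbers, typed as a numClosedFieldType: this is what
   equips it, and the matrices over it, with the usual topology. *)
Definition Cplx (R : realType) : numClosedFieldType := R[i].

Definition of_real (R : realType) (x : R) : Cplx R := (x%:C)%C.

Definition im_part (R : realType) (z : Cplx R) : R := complex.Im z.

Definition expmx (R : realType) (n : nat) (A : 'M[Cplx R]_n) : 'M[Cplx R]_n :=
  limn (series (fun k : nat => (k`!%:R)^-1 *: A ^+ k)).

(* \tr (A A^* ) is a nonnegative real, so taking its real part loses nothing. *)
Definition frobenius_norm (R : realType) (n : nat) (A : 'M[Cplx R]_n) : R :=
  Num.sqrt (complex.Re (\tr (A *m A ^t*))).

Definition GL (R : realType) (n : nat) : set 'M[Cplx R]_n :=
  [set M | M \in unitmx].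
Arguments GL : clear implicits.

Definition unitary_group (R : realType) (n : nat) : set 'M[Cplx R]_n :=
  [set M | M \is unitarymx].
Arguments unitary_group : clear implicits.

Definition subgroup_of_GL (R : realType) (n : nat) (G : set 'M[Cplx R]_n) :
    Prop :=
  [/\ G `<=` GL R n,
      G 1%:M,
      forall A B, G A -> G B -> G (A *m B)
    & forall A, G A -> G (invmx A)].

Definition closed_in_GL (R : realType) (n : nat) (G : set 'M[Cplx R]_n) :
    Prop :=
  exists2 F : set 'M[Cplx R]_n, closed F & G = F `&` GL R n.

Definition lie_algebra (R : realType) (n : nat) (G : set 'M[Cplx R]_n) :
    set 'M[Cplx R]_n :=
  [set X | forall t : R, G (expmx (of_real t *: X))].

Definition svd_system (R : realType) (n p : nat) (A : 'I_p -> 'M[Cplx R]_n) :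
    Prop :=
  [/\ (0 < p)%N,
      forall j, A j != 0,
      forall h j, h != j -> (A h) ^t* *m A j = 0 /\ A h *m (A j) ^t* = 0
    & forall j, A j *m (A j) ^t* *m A j = A j].

Definition svd_decomposition (R : realType) (n p : nat) (s : 'I_p -> R)
    (A : 'I_p -> 'M[Cplx R]_n) (M : 'M[Cplx R]_n) : Prop :=
  [/\ svd_system A,
      forall i j : 'I_p, (i < j)%N -> s j < s i,
      forall j, 0 < s j
    & M = \sum_(j < p) of_real (s j) *: A j].

Definition svd_component (R : realType) (n : nat) (M B : 'M[Cplx R]_n) : Prop :=
  exists p : nat, exists s : 'I_p -> R, exists A : 'I_p -> 'M[Cplx R]_n,
    svd_decomposition s A M /\ exists j, B = A j.

Definition svd_closed_algebra (R : realType) (n : nat)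
    (g : set 'M[Cplx R]_n) : Prop :=
  forall M, g M -> M != 0 -> forall B, svd_component M B -> g B.

Definition svd_closed_subgroup (R : realType) (n : nat)
    (G : set 'M[Cplx R]_n) : Prop :=
  [/\ subgroup_of_GL G, closed_in_GL G & svd_closed_algebra (lie_algebra G)].

Definition plog (R : realType) (n : nat) (g : set 'M[Cplx R]_n)
    (M : 'M[Cplx R]_n) : set 'M[Cplx R]_n :=
  [set L | [/\ g L, expmx L = M
    & forall a : Cplx R, eigenvalue L a -> - pi <= im_part a <= pi]].

(* Main.v *)
(** Every X in g is skew-hermitian, X = U* diag(i t_j) U, and its SVD-components
   are the pieces U* diag(i sgn(t_j)) U cut out by the values of |t_j|; hence
   SVD-closedness says that g is stable under X |-> U* diag(i phi(t_j)) U for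
   odd phi. An odd reduction of angles modulo 2 pi into [-pi, pi] turns any
   logarithm in g into a principal one, and minimality is the inequality
   |principal angle| <= |angle|, eigenvalue by eigenvalue.

   That exp : g -> G is onto comes from minimizing broken geodesics. Cartan's
   argument shows that elements of G near 1 are exponentials, so G being
   connected, M is a product g_1 ... g_k of elements of G with
   sum (n - Re tr g_i) arbitrarily small. For k fixed, choose the g_i so that
   this sum is minimal. Varying g_i exp(tZ) and exp(-tZ) g_(i+1), the first
   variation makes (g_i - g_i* ) - (g_(i+1) - g_(i+1)* ) orthogonal to g; it lies
   in g (phi = sin), so it vanishes, and near 1 this forces g_i = g_(i+1).
   Thus M = (exp X)^k = exp(kX). *)
Require Import Defs.
From HB Require Import structures.
From mathcomp Require Import all_boot all_order all_algebra.
From mathcomp Require Import complex.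
From mathcomp Require Import all_classical all_reals all_analysis.
From mathcomp Require Import ring lra zify.

Set Implicit Arguments.
Unset Strict Implicit.
Unset Printing Implicit Defensive.

Import Order.TTheory GRing.Theory Num.Theory.
Import numFieldNormedType.Exports.

Local Open Scope classical_set_scope.
Local Open Scope ring_scope.
Local Open Scope sesquilinear_scope.

(** The energy [n - Re tr g] is preferred to the squared length of a logarithm because it makes
    sense on all of [G] before any logarithm is known. It is affine in [g], so its first variation
    along [Z] is [- Re tr (g Z)]. On unitary matrices it is half the squared Frobenius distance to
    1, so a small total keeps every factor near 1. Compactness of [G] gives a minimum. The gradient
    that appears is the skew-hermitian part of [g]; in a general closed subgroup the variation only
    controls its projection to the Lie algebra, and SVD-closedness is what puts the whole of it
    there.

    No manifold structure is at hand at the start. The Lie algebra is defined by one-parameter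
    subgroups, and its stability under sums comes from identifying it with the limits of difference
    quotients of elements of [G]. The inverse function theorem is replaced by one estimate,
    [nm_expmx_dist]: near 0 the map [exp - id] has a small Lipschitz constant. *)

Local Notation re := (@complex.Re _).
Local Notation im := (@complex.Im _).

(** * Real and imaginary parts *)

Section ComplexParts.
Variable R : realType.
Implicit Types z w : Cplx R.

Lemma Cplx_eqP z w : re z = re w -> im z = im w -> z = w.
Proof. by case: z w => [a b] [c d] /= -> ->. Qed.
Lemma reD z w : re (z + w) = re z + re w. Proof. by case: z w => ? ? []. Qed.
Lemma imD z w : im (z + w) = im z + im w. Proof. by case: z w => ? ? []. Qed.
Lemma reN z : re (- z) = - re z. Proof. by case: z. Qed.
Lemma imN z : im (- z) = - im z. Proof. by case: z. Qed.
Lemma reB z w : re (z - w) = re z - re w. Proof. by rewrite reD reN. Qed.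
Lemma imB z w : im (z - w) = im z - im w. Proof. by rewrite imD imN. Qed.
Lemma reM z w : re (z * w) = re z * re w - im z * im w.
Proof. by case: z w => ? ? []. Qed.
Lemma imM z w : im (z * w) = re z * im w + im z * re w.
Proof. by case: z w => ? ? []. Qed.
Lemma re_conj z : re (z^*)%R = re z. Proof. by case: z. Qed.
Lemma im_conj z : im (z^*)%R = - im z. Proof. by case: z. Qed.
Lemma re_sum I (r : seq I) (P : pred I) (F : I -> Cplx R) :
  re (\sum_(i <- r | P i) F i) = \sum_(i <- r | P i) re (F i).
Proof. by apply: (big_morph _ reD). Qed.
Lemma im_sum I (r : seq I) (P : pred I) (F : I -> Cplx R) :
  im (\sum_(i <- r | P i) F i) = \sum_(i <- r | P i) im (F i).
Proof. by apply: (big_morph _ imD). Qed.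

Lemma of_realD (a b : R) : of_real (a + b) = of_real a + of_real b.
Proof. by apply: Cplx_eqP; rewrite ?reD ?imD /= ?addr0. Qed.
Lemma of_realM (a b : R) : of_real (a * b) = of_real a * of_real b.
Proof. by apply: Cplx_eqP; rewrite ?reM ?imM /=; ring. Qed.
Lemma of_realN (a : R) : of_real (- a) = - of_real a.
Proof. by apply: Cplx_eqP; rewrite ?reN ?imN /= ?oppr0. Qed.
Lemma of_real0 : of_real (0 : R) = 0. Proof. by []. Qed.
Lemma of_real1 : of_real (1 : R) = 1. Proof. by []. Qed.
Lemma of_real_nat k : of_real (k%:R : R) = k%:R.
Proof. by elim: k => // k IH; rewrite -addn1 !natrD of_realD IH. Qed.
Lemma of_realV (a : R) : of_real a^-1 = (of_real a)^-1.
Proof.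
have [->|a0] := eqVneq a 0; first by rewrite of_real0 !invr0.
have ca0 : of_real a != 0 by apply: contra_neq a0 => /(congr1 re).
by apply: (mulfI ca0); rewrite -of_realM !mulfV.
Qed.
Lemma conj_of_real (a : R) : ((of_real a)^*)%R = of_real a.
Proof. by apply: Cplx_eqP; rewrite ?re_conj ?im_conj /= ?oppr0. Qed.
Lemma of_real_re (z : Cplx R) : im z = 0 -> z = of_real (re z).
Proof. by move=> z0; apply: Cplx_eqP. Qed.

Lemma of_real_le (a b : R) : (of_real a <= of_real b) = (a <= b).
Proof. exact: lecR. Qed.
Lemma of_real_lt (a b : R) : (of_real a < of_real b) = (a < b).
Proof. exact: ltcR. Qed.
Lemma of_real_gt0 (a : R) : (0 < of_real a) = (0 < a).
Proof. exact: of_real_lt. Qed.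

(** The modulus [|z|] is an element of [Cplx R]; this equivalent norm has values in [R], where real
    arithmetic applies directly. *)
Definition abs1 z : R := `|re z| + `|im z|.

Lemma abs1_ge0 z : 0 <= abs1 z. Proof. by rewrite addr_ge0. Qed.
Lemma abs1D z w : abs1 (z + w) <= abs1 z + abs1 w.
Proof. by rewrite /abs1 reD imD addrACA lerD// ler_normD. Qed.
Lemma abs1N z : abs1 (- z) = abs1 z.
Proof. by rewrite /abs1 reN imN !normrN. Qed.
Lemma abs1M z w : abs1 (z * w) <= abs1 z * abs1 w.
Proof.
rewrite /abs1 reM imM mulrDl !mulrDr -!normrM.
apply: (le_trans (lerD (ler_normB _ _) (ler_normD _ _))); lra.
Qed.
Lemma abs1_realM a z : abs1 (of_real a * z) = `|a| * abs1 z.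
Proof. by rewrite /abs1 reM imM /= !mul0r subr0 addr0 !normrM mulrDr. Qed.
Lemma abs1_conj z : abs1 (z^*)%R = abs1 z.
Proof. by rewrite /abs1 re_conj im_conj normrN. Qed.
Lemma abs1_eq0 z : abs1 z = 0 -> z = 0.
Proof.
move=> /eqP; rewrite paddr_eq0// !normr_eq0 => /andP[/eqP a /eqP b].
exact: Cplx_eqP.
Qed.
Lemma normc_le_abs1 z : `|z| <= of_real (abs1 z).
Proof.
case: z => a b; rewrite normc_def /abs1 /of_real lecR /=.
rewrite -[leRHS]ger0_norm ?addr_ge0// -sqrtr_sqr ler_wsqrtr// sqrrD.
by rewrite !real_normK ?num_real// addrAC lerDl mulrn_wge0// mulr_ge0.
Qed.
Lemma abs1_le_normc z : of_real (abs1 z) <= 2%:R * `|z|.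
Proof.
have H (x : R) : 0 <= x -> 2%:R * (x%:C)%C = (2%:R * x)%:C%C.
  by move=> _; rewrite rmorphM /= rmorph_nat.
case: z => a b; rewrite normc_def H ?sqrtr_ge0// /abs1 /of_real lecR /=.
rewrite mulr_natl mulr2n lerD// -sqrtr_sqr ler_wsqrtr// ?lerDl ?lerDr sqr_ge0//.
Qed.

End ComplexParts.

(** * An entrywise norm on complex matrices *)

Section EntrywiseNorm.
Variables (R : realType) (n : nat).
Implicit Types A B : 'M[Cplx R]_n.

(** Summing the entries, rather than taking their maximum, makes the norm submultiplicative ([nmM]),
    as power series require. *)
Definition nm A : R := \sum_i \sum_j abs1 (A i j).

Lemma nm_ge0 A : 0 <= nm A.
Proof. by do 2!apply: sumr_ge0 => ? _; exact: abs1_ge0. Qed.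

Lemma nmD A B : nm (A + B) <= nm A + nm B.
Proof.
rewrite /nm -big_split; apply: ler_sum => i _ /=.
by rewrite -big_split; apply: ler_sum => j _ /=; rewrite mxE abs1D.
Qed.

Lemma nmN A : nm (- A) = nm A.
Proof.
by apply: eq_bigr => i _; apply: eq_bigr => j _; rewrite mxE abs1N.
Qed.

Lemma nmB A B : nm (A - B) <= nm A + nm B.
Proof. by rewrite -(nmN B) nmD. Qed.

Lemma nm_distC A B : nm (A - B) = nm (B - A).
Proof. by rewrite -nmN opprB. Qed.

Lemma nm_dist_triangle B A C : nm (A - C) <= nm (A - B) + nm (B - C).
Proof. by apply: le_trans (nmD _ _); rewrite addrA subrK. Qed.

Lemma nm0 : nm 0 = 0.
Proof.
rewrite /nm big1// => i _; rewrite big1// => j _.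
by rewrite mxE /abs1 /= normr0 addr0.
Qed.

Lemma abs1_le_nm A i j : abs1 (A i j) <= nm A.
Proof.
rewrite /nm (bigD1 i)//= (bigD1 j)//= -addrA lerDl addr_ge0//.
  by apply: sumr_ge0 => ? _; exact: abs1_ge0.
by do 2!apply: sumr_ge0 => ? _; exact: abs1_ge0.
Qed.

Lemma nm_eq0 A : nm A = 0 -> A = 0.
Proof.
move=> A0; apply/matrixP => i j; rewrite mxE; apply: abs1_eq0.
by apply: le_anti; rewrite abs1_ge0 -A0 abs1_le_nm.
Qed.

Lemma nm_gt0 A : A != 0 -> 0 < nm A.
Proof.
by move=> A0; rewrite lt_neqAle nm_ge0 andbT eq_sym; apply: contra_neq A0 => /nm_eq0.
Qed.

Lemma abs1_sum I (r : seq I) (P : pred I) (F : I -> Cplx R) :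
  abs1 (\sum_(i <- r | P i) F i) <= \sum_(i <- r | P i) abs1 (F i).
Proof.
elim/big_rec2: _ => [|i y x _ H]; first by rewrite /abs1 /= normr0 addr0.
by apply: (le_trans (abs1D _ _)); rewrite lerD2l.
Qed.

Lemma nmM A B : nm (A *m B) <= nm A * nm B.
Proof.
have step i j : abs1 ((A *m B) i j) <=
    \sum_k abs1 (A i k) * abs1 (B k j).
  rewrite mxE; apply: (le_trans (abs1_sum _ _ _)).
  by apply: ler_sum => k _; exact: abs1M.
rewrite [in leRHS]/nm big_distrl /=; apply: ler_sum => i _.
apply: (@le_trans _ _ (\sum_j \sum_k abs1 (A i k) * abs1 (B k j))).
  by apply: ler_sum => j _; exact: step.
rewrite exchange_big big_distrl /=; apply: ler_sum => k _.
rewrite -big_distrr /= ler_wpM2l ?abs1_ge0//.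
rewrite /nm [leRHS](bigD1 k)//= lerDl.
by do 2!apply: sumr_ge0 => ? _; exact: abs1_ge0.
Qed.

Lemma nmZ (a : R) A : nm (of_real a *: A) = `|a| * nm A.
Proof.
rewrite /nm mulr_sumr; apply: eq_bigr => i _; rewrite mulr_sumr.
by apply: eq_bigr => j _; rewrite mxE abs1_realM.
Qed.

Lemma nm_conj A : nm (A ^t*) = nm A.
Proof.
rewrite /nm exchange_big; apply: eq_bigr => i _.
by apply: eq_bigr => j _; rewrite !mxE abs1_conj.
Qed.

Lemma re_tr_le_nm A : `|re (\tr A)| <= nm A.
Proof.
rewrite /mxtrace re_sum; apply: (le_trans (ler_norm_sum _ _ _)).
apply: ler_sum => i _; rewrite [leRHS](bigD1 i)//=.
rewrite -[leLHS]addr0 lerD ?lerDl ?normr_ge0//.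
by apply: sumr_ge0 => ? _; exact: abs1_ge0.
Qed.

Lemma nmX A k : nm (A ^+ k.+1) <= nm A ^+ k.+1.
Proof.
elim: k => [|k IH]; first by rewrite !expr1.
rewrite exprS [leRHS]exprS; apply: (le_trans (nmM _ _)).
by rewrite ler_wpM2l ?nm_ge0.
Qed.

(** Each entry of a unitary matrix has [abs1] at most 2. The successor keeps the bound at least 1
    even when [n = 0]. *)
Definition unitary_bound : R := (n * n * 2).+1%:R.

Lemma unitary_bound_ge1 : 1 <= unitary_bound.
Proof. by rewrite /unitary_bound ler1n. Qed.

Lemma unitary_bound_gt0 : 0 < unitary_bound.
Proof. by rewrite ltr0n. Qed.

Lemma re_im_unitary_le A i j : A *m A ^t* = 1%:M ->
  re (A i j) ^+ 2 + im (A i j) ^+ 2 <= 1.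
Proof.
move=> /matrixP /(_ i i) /(congr1 re); rewrite !mxE eqxx re_sum /= => <-.
have E k : re (A i k * (A ^t*) k i) = re (A i k) ^+ 2 + im (A i k) ^+ 2.
  by rewrite !mxE reM re_conj im_conj mulrN opprK !expr2.
rewrite (bigD1 j)//= E lerDl; apply: sumr_ge0 => k _.
by rewrite E addr_ge0 ?sqr_ge0.
Qed.

Lemma nm_unitary A : A *m A ^t* = 1%:M -> nm A <= unitary_bound.
Proof.
move=> AU; rewrite /unitary_bound.
apply: (@le_trans _ _ (\sum_(i < n) \sum_(j < n) (2%:R : R))).
  apply: ler_sum => i _; apply: ler_sum => j _.
  have := re_im_unitary_le i j AU; rewrite /abs1.
  set a := re _; set b := im _ => H.
  have Ha : a ^+ 2 <= 1 by have := sqr_ge0 b; lra.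
  have Hb : b ^+ 2 <= 1 by have := sqr_ge0 a; lra.
  have abs_le1 (x : R) : x ^+ 2 <= 1 -> `|x| <= 1.
    by move=> x2; rewrite ler_norml; apply/andP; split; nra.
  by have := abs_le1 a Ha; have := abs_le1 b Hb; lra.
rewrite !sumr_const !card_ord -!mulrnA ler_nat; lia.
Qed.

End EntrywiseNorm.

(** * Topology and compactness through the entrywise norm *)

Section EntrywiseTopology.
Variables (R : realType) (n : nat).
Implicit Types A B M : 'M[Cplx R]_n.

(** Converts a bound on every entry into a bound on [nm]: the factor 2 compares [abs1] with the
    modulus, and the successor in the denominator makes the inequality strict. *)
Lemma sum_small_lt (e : R) : 0 < e ->
  \sum_(i < n) \sum_(j < n) (2%:R * (e / (n * n * 2).+1%:R)) < e.
Proof.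
move=> e0; rewrite !sumr_const !card_ord -mulrnA -[_ *+ _]mulr_natr.
set N : R := (n * n)%:R; have N0 : 0 <= N by rewrite ler0n.
have -> : (n * n * 2).+1%:R = N * 2 + 1 :> R by rewrite -addn1 natrD natrM.
have N1 : 0 < N * 2 + 1 by lra.
by rewrite mulrA mulrAC ltr_pdivrMr//; nra.
Qed.

Lemma nbhs_nmP A (P : set 'M[Cplx R]_n) :
  nbhs A P <-> exists2 e : R, 0 < e & forall B, nm (B - A) < e -> P B.
Proof.
split.
  (* Radii of balls are elements of [Cplx R]; a positive one is real. *)
  move=> /nbhs_ballP [e e0 sP]; have [e' eE] : exists e' : R, e = of_real e'.
    by exists (re e); apply: of_real_re; move: e0; rewrite /= ltcE => /andP[/eqP].
  move: e0; rewrite eE /= of_real_gt0 => e0; exists e' => // B AB; apply: sP.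
  split; first by rewrite eE /= of_real_gt0.
  move=> i j; rewrite /ball /= eE; apply: (le_lt_trans (normc_le_abs1 _)).
  rewrite of_real_lt; apply: le_lt_trans AB; rewrite nm_distC.
  by have := abs1_le_nm (A - B) i j; rewrite !mxE.
move=> [e e0 sP]; apply/nbhs_ballP.
pose d : R := e / (n * n * 2).+1%:R.
have d0 : 0 < d by rewrite divr_gt0// ltr0n.
exists (of_real d); first by rewrite /= of_real_gt0.
move=> B [_ AB]; apply: sP.
apply: (@le_lt_trans _ _ (\sum_(i < n) \sum_(j < n) (2%:R * d))).
  apply: ler_sum => i _; apply: ler_sum => j _.
  rewrite -of_real_le; apply: (le_trans (abs1_le_normc _)).
  rewrite of_realM of_real_nat ler_wpM2l// ?ler0n//.
  by rewrite !mxE distrC; exact: ltW (AB i j).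
exact: sum_small_lt.
Qed.

Lemma near_nm A (e : R) : 0 < e -> \forall B \near A, nm (B - A) < e.
Proof. by move=> e0; apply/nbhs_nmP; exists e. Qed.

Lemma cvg_nmP {T : Type} (F : set_system T) (f : T -> 'M[Cplx R]_n) A :
  Filter F ->
  f @ F --> A <-> forall e : R, 0 < e -> \forall x \near F, nm (f x - A) < e.
Proof.
move=> FF; split=> [fA e e0|fA P /nbhs_nmP[e e0 sP]].
  by apply: (fA [set B | nm (B - A) < e]); exact: near_nm.
by apply: filterS (fA e e0) => x; exact: sP.
Qed.

Lemma mx_hausdorff : hausdorff_space 'M[Cplx R]_n.
Proof.
move=> A B AB; apply/eqP; rewrite -subr_eq0; apply/eqP/nm_eq0/eqP.
apply: contraT => AB0; pose d := nm (A - B) / 2.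
have d0 : 0 < d by rewrite divr_gt0// lt_neqAle eq_sym AB0 nm_ge0.
have [C []] := AB _ _ (near_nm A d0) (near_nm B d0).
rewrite /= (nm_distC C A) => CA CB.
by have := nm_dist_triangle C A B; rewrite /d in CA CB; lra.
Qed.

Lemma closed_nm (P : set 'M[Cplx R]_n) :
  closed P <->
  (forall A, (forall e : R, 0 < e -> exists2 B, P B & nm (B - A) < e) -> P A).
Proof.
split=> [cP A H|H A clA].
  apply: cP => Q /nbhs_nmP[e e0 sQ].
  by have [B PB AB] := H e e0; exists B; split => //; exact: sQ.
by apply: H => e e0; have [B [PB AB]] := clA _ (near_nm A e0); exists B.
Qed.

Lemma continuous_nm {T : topologicalType} (f : T -> 'M[Cplx R]_n) :
  continuous f -> continuous (fun x => nm (f x)).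
Proof.
move=> cf x; apply/cvgrPdist_lt => e e0.
near=> y; have : nm (f y - f x) < e.
  by near: y; exact: (cvg_nmP _ _ _).1 (cf x) e e0.
apply: le_lt_trans; rewrite ler_norml.
have := nm_dist_triangle (f x) (f y) 0; have := nm_dist_triangle (f y) (f x) 0.
by rewrite !subr0 (nm_distC (f x)); lra.
Unshelve. all: by end_near. Qed.

Lemma continuous_mulmx {T : topologicalType} (f g : T -> 'M[Cplx R]_n) :
  continuous f -> continuous g -> continuous (fun x => f x *m g x).
Proof.
move=> cf cg x; apply/cvg_nmP => e e0.
(* Since [d <= 1], the product of the two increments is at most [d], so the three error terms add up
   to at most [d * a <= e / 2]. *)
pose a := nm (f x) + nm (g x) + 1.
have a1 : 1 <= a by rewrite lerDr addr_ge0 ?nm_ge0.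
pose d := Num.min 1 (e / (2 * a)).
have d0 : 0 < d by rewrite lt_min ltr01 divr_gt0// mulr_gt0//; lra.
near=> y.
have fd : nm (f y - f x) < d by near: y; exact: (cvg_nmP _ _ _).1 (cf x) _ d0.
have gd : nm (g y - g x) < d by near: y; exact: (cvg_nmP _ _ _).1 (cg x) _ d0.
have -> : f y *m g y - f x *m g x =
    (f y - f x) *m (g y - g x) + (f y - f x) *m g x + f x *m (g y - g x).
  by rewrite -mulmxDr subrK mulmxBl mulmxBr addrA subrK.
apply: (@le_lt_trans _ _ (d * 1 + d * nm (g x) + nm (f x) * d)).
  apply: (le_trans (nmD _ _)); apply: lerD; last first.
    by apply: (le_trans (nmM _ _)); rewrite ler_wpM2l ?nm_ge0// ltW.
  apply: (le_trans (nmD _ _)); apply: lerD; last first.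
    by apply: (le_trans (nmM _ _)); rewrite ler_wpM2r ?nm_ge0// ltW.
  apply: (le_trans (nmM _ _)); apply: ler_pM; rewrite ?nm_ge0// ltW//.
  by apply: (lt_le_trans gd); rewrite ge_min lexx.
have -> : d * 1 + d * nm (g x) + nm (f x) * d = d * a by rewrite /a; ring.
apply: (@le_lt_trans _ _ (e / 2)); last by lra.
have : d <= e / (2 * a) by rewrite ge_min lexx orbT.
move=> /(ler_wpM2r (_ : 0 <= a)) -/(_ ltac:(lra)) => H; apply: (le_trans H).
by rewrite invfM mulrA mulfVK// gt_eqF//; lra.
Unshelve. all: by end_near. Qed.

Lemma continuous_re_tr {T : topologicalType} (f : T -> 'M[Cplx R]_n) :
  continuous f -> continuous (fun x => re (\tr (f x))).
Proof.
move=> cf x; apply/cvgrPdist_lt => e e0.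
near=> y; have : nm (f y - f x) < e.
  by near: y; exact: (cvg_nmP _ _ _).1 (cf x) e e0.
apply: le_lt_trans; rewrite -reB -raddfB /=.
by apply: (le_trans (re_tr_le_nm _)); rewrite nm_distC.
Unshelve. all: by end_near. Qed.

Lemma cvg_entries {T : Type} (F : set_system T) (f : T -> 'M[Cplx R]_n) A :
    Filter F ->
    (forall i j, re (f x i j) @[x --> F] --> re (A i j)) ->
    (forall i j, im (f x i j) @[x --> F] --> im (A i j)) ->
  f @ F --> A.
Proof.
move=> FF fre fim; apply/cvg_nmP => e e0.
pose d : R := e / (n * n * 2).+1%:R.
have d0 : 0 < d by rewrite divr_gt0// ltr0n.
have Hre : \forall x \near F, forall i : 'I_n * 'I_n,
    `|re (A i.1 i.2) - re (f x i.1 i.2)| < d.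
  by apply: filter_forall => i; have /cvgrPdist_lt := fre i.1 i.2; exact.
have Him : \forall x \near F, forall i : 'I_n * 'I_n,
    `|im (A i.1 i.2) - im (f x i.1 i.2)| < d.
  by apply: filter_forall => i; have /cvgrPdist_lt := fim i.1 i.2; exact.
apply: filterS2 Hre Him => x Hre Him.
apply: le_lt_trans (sum_small_lt e0).
apply: ler_sum => i _; apply: ler_sum => j _.
rewrite !mxE /abs1 reB imB mulr_natl mulr2n distrC (distrC (im _)).
by apply: lerD; apply: ltW; [have := Hre (i, j)|have := Him (i, j)].
Qed.

Definition mx_of_coords (f : prod_topology (fun _ : 'I_n * 'I_n * bool => R)) :
    'M[Cplx R]_n :=
  \matrix_(i, j) Complex (f (i, j, false)) (f (i, j, true)).

Lemma continuous_mx_of_coords : continuous mx_of_coords.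
Proof.
move=> f; apply: (@cvg_entries _ (nbhs f) mx_of_coords) => i j; rewrite mxE.
  apply: cvg_trans (@proj_continuous _ (fun=> R) (i, j, false) f).
  by apply: near_eq_cvg; near=> x; rewrite mxE.
apply: cvg_trans (@proj_continuous _ (fun=> R) (i, j, true) f).
by apply: near_eq_cvg; near=> x; rewrite mxE.
Unshelve. all: by end_near. Qed.

(** The ball is a closed subset of the continuous image of a cube of real coordinates, which is
    compact by Tychonoff. *)
Lemma compact_nm_le (r : R) : compact [set A : 'M[Cplx R]_n | nm A <= r].
Proof.
pose K : set (prod_topology (fun _ : 'I_n * 'I_n * bool => R)) :=
  [set f | forall i, [set` `[- r, r]] (f i)].
have cK : compact K.
  by apply: (@tychonoff _ (fun=> R) (fun=> [set` `[- r, r]])) => i; exact: segment_compact.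
apply: (@subclosed_compact _ _ (mx_of_coords @` K)).
- apply/closed_nm => A H; rewrite /= leNgt; apply/negP => rA.
  have [B /= Br AB] := H (nm A - r) ltac:(by rewrite subr_gt0).
  by have := nm_dist_triangle B A 0; rewrite !subr0 (nm_distC A); lra.
- exact: continuous_compact (continuous_subspaceT continuous_mx_of_coords) cK.
- move=> A /= Ar.
  exists (fun i => if i.2 then im (A i.1.1 i.1.2) else re (A i.1.1 i.1.2)).
    move=> [[i j] b] /=; rewrite in_itv /= -ler_norml.
    apply: le_trans Ar; apply: le_trans (abs1_le_nm A i j); rewrite /abs1.
    by case: b; rewrite ?lerDl ?lerDr.
  by apply/matrixP => i j; rewrite mxE; apply: Cplx_eqP.
Qed.

Lemma compact_nm (K : set 'M[Cplx R]_n) (r : R) :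
  closed K -> (forall A, K A -> nm A <= r) -> compact K.
Proof. by move=> cK Kr; exact: subclosed_compact cK (@compact_nm_le r) Kr. Qed.

(** Bolzano-Weierstrass without extracting a subsequence: good indices exist beyond every [N]. *)
Lemma nm_cluster (u : nat -> 'M[Cplx R]_n) (r : R) :
  (forall k, nm (u k) <= r) ->
  exists Y, forall (e : R) N, 0 < e -> exists2 k, (N <= k)%N & nm (u k - Y) < e.
Proof.
move=> ur; have : (u @ \oo) [set A : 'M[Cplx R]_n | nm A <= r] by exists 0%N => // k _; exact: ur.
move=> /(@compact_nm_le r) [Y [_ clY]]; exists Y => e N e0.
have uN : (u @ \oo) [set B | exists2 k, (N <= k)%N & B = u k].
  by exists N => // k Nk; exists k.
by have [_ [[k Nk ->] kY]] := clY _ _ uN (near_nm Y e0); exists k.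
Qed.

End EntrywiseTopology.

(** * The matrix exponential *)

Section MatrixExponential.
Variables (R : realType) (n : nat).
Implicit Types A B X Y : 'M[Cplx R]_n.

Definition exp_term A (k : nat) : 'M[Cplx R]_n := (k`!%:R)^-1 *: A ^+ k.

Lemma exp_termE A k : exp_term A k = of_real (k`!%:R)^-1 *: A ^+ k.
Proof. by rewrite of_realV of_real_nat. Qed.

(** The constant is there for [k = 0], because the norm of the identity matrix is [n] and not 1. *)
Lemma nm_exp_term A k :
  nm (exp_term A k) <= unitary_bound R n * exp_coeff (nm A) k.
Proof.
rewrite exp_termE nmZ ger0_norm ?invr_ge0 ?ler0n// /exp_coeff /= mulrC mulrA.
rewrite ler_wpM2r ?invr_ge0 ?ler0n//; case: k => [|k].
  rewrite expr0 mulr1; apply: nm_unitary.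
  by rewrite mul1mx trmx1 map_mx1.
rewrite (le_trans (nmX A k))// ler_peMl ?unitary_bound_ge1//.
by rewrite exprn_ge0 ?nm_ge0.
Qed.

Lemma cvg_series_dominated (u : nat -> R) A :
  (forall k, `|u k| <= nm (exp_term A k)) -> cvgn (series u).
Proof.
move=> uA; apply: normed_cvg.
apply: (@series_le_cvg _ _ (unitary_bound R n *: exp_coeff (nm A))).
- by move=> k /=; rewrite normr_ge0.
- move=> k; apply: mulr_ge0; first exact: ltW (unitary_bound_gt0 R n).
  by apply: exp_coeff_ge0; exact: nm_ge0.
- by move=> k; apply: le_trans (uA k) _; exact: nm_exp_term.
- by apply: is_cvg_seriesZ; exact: is_cvg_series_exp_coeff.
Qed.

Lemma re_entry_le A i j : `|re (A i j)| <= nm A.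
Proof. by apply: le_trans (abs1_le_nm A i j); rewrite lerDl. Qed.

Lemma im_entry_le A i j : `|im (A i j)| <= nm A.
Proof. by apply: le_trans (abs1_le_nm A i j); rewrite lerDr. Qed.

Lemma re_series (u : nat -> 'M[Cplx R]_n) N i j :
  re (series u N i j) = series (fun k => re (u k i j)) N.
Proof. by rewrite /series /= summxE re_sum. Qed.

Lemma im_series (u : nat -> 'M[Cplx R]_n) N i j :
  im (series u N i j) = series (fun k => im (u k i j)) N.
Proof. by rewrite /series /= summxE im_sum. Qed.

Lemma expmx_unique A B : series (exp_term A) @ \oo --> B -> expmx A = B.
Proof. exact: cvg_lim (@mx_hausdorff R n) _ _ _ _ _. Qed.

(** [expmx] is a [limn], which says nothing until convergence is known; the limit is first built
    entry by entry from absolutely convergent real series. *)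
Lemma expmx_cvg A : series (exp_term A) @ \oo --> expmx A.
Proof.
pose L : 'M[Cplx R]_n := \matrix_(i, j) Complex
  (limn (series (fun k => re (exp_term A k i j))))
  (limn (series (fun k => im (exp_term A k i j)))).
suff H : series (exp_term A) @ \oo --> L by rewrite (expmx_unique H).
apply: cvg_entries => i j; rewrite mxE /=.
- under eq_fun do rewrite re_series.
  by apply: (@cvg_series_dominated _ A) => k; exact: re_entry_le.
- under eq_fun do rewrite im_series.
  by apply: (@cvg_series_dominated _ A) => k; exact: im_entry_le.
Qed.

Lemma expmx0 : expmx (0 : 'M[Cplx R]_n) = 1%:M.
Proof.
apply: expmx_unique; apply: (@cvg_near_cst _ _ (1%:M : 'M[Cplx R]_n)).
exists 1%N => // -[//|N] _; rewrite /series /= big_nat_recl// big1 ?addr0.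
  by rewrite /exp_term expr0 fact0 invr1 scale1r.
by move=> k _; rewrite /exp_term expr0n /= scaler0.
Qed.

Lemma nm_expX_dist X Y r k : nm X <= r -> nm Y <= r ->
  nm (X ^+ k.+1 - Y ^+ k.+1) <= k.+1%:R * r ^+ k * nm (X - Y).
Proof.
move=> Xr Yr; have r0 : 0 <= r := le_trans (nm_ge0 X) Xr.
elim: k => [|k IH]; first by rewrite !expr1 expr0 !mul1r.
rewrite [X ^+ _]exprS [Y ^+ _]exprS.
have -> : X * X ^+ k.+1 - Y * Y ^+ k.+1 =
    X *m (X ^+ k.+1 - Y ^+ k.+1) + (X - Y) *m Y ^+ k.+1.
  by rewrite mulmxBr mulmxBl addrA subrK.
apply: (le_trans (nmD _ _)).
have -> : k.+2%:R * r ^+ k.+1 * nm (X - Y) =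
    r * (k.+1%:R * r ^+ k * nm (X - Y)) + nm (X - Y) * r ^+ k.+1.
  by rewrite -[k.+2]addn1 natrD exprS; ring.
apply: lerD; apply: (le_trans (nmM _ _)).
  by apply: ler_pM; rewrite ?nm_ge0.
rewrite ler_wpM2l ?nm_ge0// (le_trans (nmX Y k))//.
by rewrite lerXn2r// nnegrE ?nm_ge0.
Qed.

Lemma cvgB_mx (u v : nat -> 'M[Cplx R]_n) A B :
  u @ \oo --> A -> v @ \oo --> B -> (fun k => u k - v k) @ \oo --> A - B.
Proof.
move=> /cvg_nmP uA /cvg_nmP vB; apply/cvg_nmP => e e0.
have e20 : 0 < e / 2 by lra.
apply: filterS2 (uA _ e20) (vB _ e20) => k Hu Hv.
have -> : u k - v k - (A - B) = (u k - A) - (v k - B).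
  by rewrite !opprB addrACA [RHS]addrACA [- v k + _]addrC.
by apply: (le_lt_trans (nmB _ _)); lra.
Qed.

Lemma nm_le_lim (u : nat -> 'M[Cplx R]_n) A B (c : R) N :
  u @ \oo --> A -> (forall k, (N <= k)%N -> nm (u k - B) <= c) -> nm (A - B) <= c.
Proof.
move=> /cvg_nmP uA uc; apply/ler_addgt0Pr => e e0.
near \oo => k; have Hk : nm (u k - A) < e by near: k; exact: uA.
have Nk : (N <= k)%N by near: k; exact: nbhs_infty_ge.
have := nm_dist_triangle (u k) A B; rewrite (nm_distC A (u k)).
by have := uc k Nk; lra.
Unshelve. all: by end_near. Qed.

Lemma series_exp_le (r : R) N : 0 <= r -> series (exp_coeff r) N <= expR r.
Proof.
move=> r0; apply: nondecreasing_cvgn_le; last exact: is_cvg_series_exp_coeff.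
by apply/nondecreasing_series => k _ _; exact: exp_coeff_ge0.
Qed.

Definition exp_partial A N : 'M[Cplx R]_n := series (exp_term A) N.

Lemma exp_partialS A N : exp_partial A N.+1 = exp_partial A N + exp_term A N.
Proof. by rewrite /exp_partial /series /= big_nat_recr. Qed.

Lemma exp_partial2 A : exp_partial A 2 = 1%:M + A.
Proof.
rewrite !exp_partialS /exp_partial /series /= big_geq// add0r.
by rewrite /exp_term expr0 expr1 invr1 !scale1r.
Qed.

(** Subtracting [X - Y] cancels the terms of degree 0 and 1. The term of degree [k + 1] has
    Lipschitz constant [r ^ k / k!] on the ball, and these sum to [expR r - 1] over [k >= 1]. Taylor
    bounds, continuity and local injectivity all follow from this. *)
Lemma nm_expmx_dist X Y r : nm X <= r -> nm Y <= r ->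
  nm (expmx X - expmx Y - (X - Y)) <= (expR r - 1) * nm (X - Y).
Proof.
move=> Xr Yr; have r0 : 0 <= r := le_trans (nm_ge0 X) Xr.
have partial N : nm (exp_partial X N.+2 - exp_partial Y N.+2
    - (X - Y)) <= (series (exp_coeff r) N.+1 - 1) * nm (X - Y).
  elim: N => [|N IH].
    rewrite !exp_partial2 opprD addrACA subrr add0r subrr nm0.
    by rewrite seriesSr /series /= big_geq// add0r /exp_coeff /= divr1 subrr mul0r.
  rewrite (exp_partialS X) (exp_partialS Y) seriesSr.
  rewrite opprD addrACA [_ + _ - (X - Y)]addrAC.
  apply: (le_trans (nmD _ _)); rewrite [_ + exp_coeff _ _ - 1]addrAC mulrDl.
  apply: lerD => //; rewrite !exp_termE -scalerBr nmZ.
  rewrite ger0_norm ?invr_ge0 ?ler0n// /exp_coeff /=.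
  apply: (@le_trans _ _ ((N.+2)`!%:R^-1 * (N.+2%:R * r ^+ N.+1 * nm (X - Y)))).
    by apply: ler_wpM2l; [rewrite invr_ge0 ler0n|exact: nm_expX_dist].
  have k0 : (N.+2%:R : R) != 0 by rewrite pnatr_eq0.
  rewrite factS natrM invfM -!mulrA [(N.+1)`!%:R^-1 * _]mulrCA mulKf//.
  by rewrite [_^-1 * _]mulrCA.
have cvgXY := cvgB_mx (@expmx_cvg X) (@expmx_cvg Y).
apply: (@nm_le_lim _ _ _ _ 2 cvgXY) => -[|[|N]]// _.
apply: (le_trans (partial N)); rewrite ler_wpM2r ?nm_ge0// lerD2r.
exact: series_exp_le.
Qed.

End MatrixExponential.

Opaque expmx.

(** * Unitary diagonalization *)

Section UnitaryDiagonalization.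
Variables (R : realType) (n : nat).
Implicit Types (U V A X : 'M[Cplx R]_n) (f g : 'I_n -> Cplx R) (t : 'I_n -> R).

(** The rows of [U] are the (left) eigenvectors, as in the spectral theorem for normal matrices. All
    later computations with functions of a matrix become pointwise computations on [f]. *)
Definition udiag U f : 'M[Cplx R]_n := U ^t* *m diag_mx (\row_j f j) *m U.

Definition cis (x : R) : Cplx R := Complex (cos x) (sin x).

Definition imag (x : R) : Cplx R := Complex 0 x.

Lemma mx_exprS A k : A ^+ k.+1 = A *m A ^+ k.
Proof. exact: exprS. Qed.

Lemma adjM A X : (A *m X) ^t* = X ^t* *m A ^t*.
Proof. by rewrite trmx_mul map_mxM. Qed.

Lemma adjK A : A ^t* ^t* = A.
Proof. exact: trmxCK. Qed.

Lemma unitary_adjl U : U *m U ^t* = 1%:M -> U ^t* *m U = 1%:M.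
Proof. exact: mulmx1C. Qed.

Lemma udiag_row U (d : 'rV[Cplx R]_n) :
  U ^t* *m diag_mx d *m U = udiag U (fun j => d 0 j).
Proof.
by rewrite /udiag (_ : \row_j d 0 j = d)//; apply/rowP => j; rewrite mxE.
Qed.

Lemma eq_udiag U f g : f =1 g -> udiag U f = udiag U g.
Proof.
by move=> fg; rewrite /udiag (_ : \row_j f j = \row_j g j)//; apply/rowP => j; rewrite !mxE fg.
Qed.

Lemma udiagM U f g : U *m U ^t* = 1%:M ->
  udiag U f *m udiag U g = udiag U (fun j => f j * g j).
Proof.
move=> UU; rewrite {1 2}/udiag !mulmxA -(mulmxA _ U (U ^t*)) UU mulmx1.
rewrite -(mulmxA (U ^t*)) mulmx_diag udiag_row.
by apply: eq_udiag => j; rewrite !mxE.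
Qed.

Lemma udiag_adj U f : (udiag U f) ^t* = udiag U (fun j => (f j)^*)%R.
Proof.
rewrite {1}/udiag !adjM adjK tr_diag_mx map_diag_mx mulmxA udiag_row.
by apply: eq_udiag => j; rewrite !mxE.
Qed.

Lemma udiagD U f g : udiag U f + udiag U g = udiag U (fun j => f j + g j).
Proof.
rewrite {1 2}/udiag -mulmxDl -mulmxDr -raddfD udiag_row.
by apply: eq_udiag => j; rewrite !mxE.
Qed.

Lemma udiagZ U (c : Cplx R) f : c *: udiag U f = udiag U (fun j => c * f j).
Proof.
rewrite {1}/udiag scalemxAl scalemxAr -linearZ udiag_row.
by apply: eq_udiag => j; rewrite !mxE.
Qed.

Lemma udiag0 U : udiag U (fun=> 0) = 0.
Proof.
rewrite /udiag (_ : (\row__ _) = 0); last by apply/rowP => j; rewrite !mxE.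
by rewrite raddf0 mulmx0 mul0mx.
Qed.

Lemma udiag1 U : U *m U ^t* = 1%:M -> udiag U (fun=> 1) = 1%:M.
Proof.
move=> UU; rewrite /udiag (_ : (\row__ _) = const_mx 1).
  by rewrite diag_const_mx mulmx1 unitary_adjl.
by apply/rowP => j; rewrite !mxE.
Qed.

Lemma udiag_sum U I (r : seq I) (F : I -> 'I_n -> Cplx R) :
  \sum_(i <- r) udiag U (F i) = udiag U (fun j => \sum_(i <- r) F i j).
Proof.
elim: r => [|i r IH].
  by rewrite big_nil -(udiag0 U); apply: eq_udiag => j; rewrite big_nil.
by rewrite big_cons IH udiagD; apply: eq_udiag => j; rewrite big_cons.
Qed.

Lemma udiagX U f k : U *m U ^t* = 1%:M ->
  udiag U f ^+ k = udiag U (fun j => f j ^+ k).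
Proof.
move=> UU; elim: k => [|k IH].
  by rewrite expr0 -[1]/(1%:M) -(udiag1 UU); apply: eq_udiag => j; rewrite expr0.
rewrite mx_exprS IH (udiagM _ _ UU).
by apply: eq_udiag => j; rewrite exprS.
Qed.

Lemma udiagK U f : U *m U ^t* = 1%:M -> U *m udiag U f *m U ^t* = diag_mx (\row_j f j).
Proof.
by move=> UU; rewrite /udiag !mulmxA UU mul1mx -mulmxA UU mulmx1.
Qed.

Lemma mul_udiag U f : U *m U ^t* = 1%:M ->
  U *m udiag U f = diag_mx (\row_j f j) *m U.
Proof. by move=> UU; rewrite /udiag !mulmxA UU mul1mx. Qed.

Lemma udiag_mul U f : U *m U ^t* = 1%:M ->
  udiag U f *m U ^t* = U ^t* *m diag_mx (\row_j f j).
Proof. by move=> UU; rewrite /udiag -mulmxA UU mulmx1. Qed.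

Lemma udiag_inj U f g : U *m U ^t* = 1%:M -> udiag U f = udiag U g -> f =1 g.
Proof.
move=> UU fg j; have := udiagK f UU; rewrite fg (udiagK _ UU).
by move=> /matrixP/(_ j j); rewrite !mxE eqxx !mulr1n.
Qed.

Opaque udiag.

Lemma skew_udiag X : X ^t* = - X ->
  exists U t, U *m U ^t* = 1%:M /\ X = udiag U (fun j => imag (t j)).
Proof.
move=> skX; have /orthomx_spectralP XE : X \is normalmx.
  by apply/normalmxP; rewrite skX mulmxN mulNmx.
set U := spectralmx X in XE.
have UU : U *m U ^t* = 1%:M by apply/unitarymxP; exact: spectral_unitarymx.
pose d j := spectral_diag X 0 j.
have Xd : X = udiag U d.
  by rewrite -udiag_row -invmx_unitary ?spectral_unitarymx.
have d_im j : re (d j) = 0.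
  have : udiag U (fun j => (d j)^*)%R = udiag U (fun j => -1 * d j).
    by rewrite -udiag_adj -udiagZ scaleN1r -Xd.
  move=> /(udiag_inj UU) /(_ j) /(congr1 re); rewrite mulN1r reN re_conj; lra.
exists U, (fun j => im (d j)); split; first exact: UU.
by rewrite Xd; apply: eq_udiag => j; apply: Cplx_eqP.
Qed.

(** The parity factors have the shape of those in the cosine and sine coefficients, so that the
    series can be matched term by term. *)
Lemma imag_expr (x : R) k : imag x ^+ k =
  Complex ((~~ odd k)%:R * (-1) ^+ k./2 * x ^+ k)
          ((odd k)%:R * (-1) ^+ k.-1./2 * x ^+ k).
Proof.
elim: k => [|k IH]; first by apply: Cplx_eqP; rewrite !expr0 /=; ring.
rewrite exprS IH; apply: Cplx_eqP; rewrite ?reM ?imM /= !exprS.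
- rewrite uphalfE; case: k {IH} => [|k]; first by rewrite /= !expr0; ring.
  by rewrite /= uphalfE !exprS; case: (odd k) => /=; ring.
- by case: (odd k) => /=; ring.
Qed.

Lemma cvg_cos_series (x : R) : series (cos_coeff x) @ \oo --> cos x.
Proof. by rewrite unlock; exact: is_cvg_series_cos_coeff. Qed.

Lemma cvg_sin_series (x : R) : series (sin_coeff x) @ \oo --> sin x.
Proof. by rewrite unlock; exact: is_cvg_series_sin_coeff. Qed.

(** Conjugation by [U] commutes with partial sums and is continuous, so the limit is taken on the
    diagonal entries, where it splits into the cosine and sine series. *)
Lemma expmx_udiag U t : U *m U ^t* = 1%:M ->
  expmx (udiag U (fun j => imag (t j))) = udiag U (fun j => cis (t j)).
Proof.
move=> UU; apply: expmx_unique.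
pose D N : 'M[Cplx R]_n :=
  diag_mx (\row_j \sum_(0 <= k < N) of_real (k`!%:R)^-1 * imag (t j) ^+ k).
have -> : series (exp_term (udiag U (fun j => imag (t j)))) =
    (fun N => U ^t* *m D N *m U).
  apply/funext => N; rewrite /series /=.
  under eq_bigr do rewrite exp_termE udiagX// udiagZ.
  by rewrite udiag_sum.
have cD : D @ \oo --> (diag_mx (\row_j cis (t j)) : 'M[Cplx R]_n).
  apply: cvg_entries => i j; rewrite !mxE; (have [->|ij] := eqVneq i j; last first).
  - under eq_fun do rewrite !mxE (negPf ij) mulr0n.
    exact: cvg_cst.
  - have -> : (fun N => re (D N j j)) = series (cos_coeff (t j)).
      apply/funext => N; rewrite !mxE eqxx mulr1n re_sum; apply: eq_bigr => k _.
      rewrite reM imag_expr /= mul0r subr0 [LHS]mulrC.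
      by rewrite cos_coeffE mulrAC -!mulrA.
    by rewrite mulr1n; exact: cvg_cos_series.
  - under eq_fun do rewrite !mxE (negPf ij) mulr0n.
    exact: cvg_cst.
  - have -> : (fun N => im (D N j j)) = series (sin_coeff (t j)).
      apply/funext => N; rewrite !mxE eqxx mulr1n im_sum; apply: eq_bigr => k _.
      by rewrite imM imag_expr /= mul0r addr0 mulrC.
    by rewrite mulr1n; exact: cvg_sin_series.
have cU : continuous (fun A : 'M[Cplx R]_n => U ^t* *m A *m U).
  apply: continuous_mulmx; last exact: cst_continuous.
  by apply: continuous_mulmx; [exact: cst_continuous|move=> A; exact: cvg_id].
exact: (cvg_comp _ _ cD (cU _)).
Qed.

Lemma cisD (x y : R) : cis (x + y) = cis x * cis y.
Proof. by apply: Cplx_eqP; rewrite ?reM ?imM /= ?cosD ?sinD//; ring. Qed.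

Lemma cis_conj (x : R) : ((cis x)^*)%R = cis (- x).
Proof. by apply: Cplx_eqP; rewrite ?re_conj ?im_conj /= ?cosN ?sinN. Qed.

Lemma skewZ (a : R) X : X ^t* = - X -> (of_real a *: X) ^t* = - (of_real a *: X).
Proof.
move=> X0; apply/matrixP => i j; move/matrixP/(_ i j): X0; rewrite !mxE => H.
by rewrite rmorphM /= H mulrN; congr (- (_ * _)); exact: conj_of_real.
Qed.

Lemma imag_scale U (a : R) t : of_real a *: udiag U (fun j => imag (t j)) =
  udiag U (fun j => imag (a * t j)).
Proof.
rewrite udiagZ; apply: eq_udiag => j.
by apply: Cplx_eqP; rewrite ?reM ?imM /=; ring.
Qed.

Lemma expmx_imag_scale U (a : R) t : U *m U ^t* = 1%:M ->
  expmx (of_real a *: udiag U (fun j => imag (t j))) = udiag U (fun j => cis (a * t j)).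
Proof.
move=> UU; rewrite imag_scale.
exact: (expmx_udiag (fun j => a * t j) UU).
Qed.

(** Both multiples of [X] are diagonalized by the same [U], so this is [cisD] on each eigenvalue; no
    Cauchy product is involved. *)
Lemma expmx_skewD X (a b : R) : X ^t* = - X ->
  expmx (of_real a *: X) *m expmx (of_real b *: X) = expmx (of_real (a + b) *: X).
Proof.
move=> /skew_udiag [U [t [UU ->]]].
rewrite (expmx_imag_scale a t UU) (expmx_imag_scale b t UU).
rewrite (expmx_imag_scale (a + b) t UU) (udiagM _ _ UU).
by apply: eq_udiag => j; rewrite -cisD mulrDl.
Qed.

Lemma expmx_skewX X (a : R) k : X ^t* = - X ->
  expmx (of_real a *: X) ^+ k = expmx (of_real (k%:R * a) *: X).
Proof.
move=> skX; elim: k => [|k IH].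
  by rewrite mul0r of_real0 scale0r expmx0.
have kE : k.+1%:R * a = a + k%:R * a by rewrite -[k.+1]addn1 natrD; ring.
by rewrite mx_exprS IH (expmx_skewD _ _ skX) kE {IH}.
Qed.

Lemma expmx_skew_adj X : X ^t* = - X -> (expmx X) ^t* = expmx (- X).
Proof.
move=> /skew_udiag [U [t [UU ->]]].
have -> : - udiag U (fun j => imag (t j)) = udiag U (fun j => imag (- t j)).
  rewrite -scaleN1r udiagZ; apply: eq_udiag => j.
  by apply: Cplx_eqP; rewrite mulN1r ?reN ?imN /= ?oppr0.
rewrite !(expmx_udiag _ UU) udiag_adj; apply: eq_udiag => j; exact: cis_conj.
Qed.

Lemma expmx_skew_unitary X : X ^t* = - X -> expmx X *m (expmx X) ^t* = 1%:M.
Proof.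
move=> skX; rewrite (expmx_skew_adj skX).
have := expmx_skewD 1 (-1) skX.
by rewrite of_realN !of_real1 scale1r scaleN1r addrN of_real0 scale0r expmx0.
Qed.

Lemma eigenvalue_udiag U f (a : Cplx R) : U *m U ^t* = 1%:M ->
  eigenvalue (udiag U f) a <-> exists j, a = f j.
Proof.
move=> UU; split.
  move=> /eigenvalueP [v vE v0].
  have w0 : v *m U ^t* != 0.
    apply: contra_neq v0 => /(congr1 (mulmx^~ U)).
    by rewrite -mulmxA (unitary_adjl UU) mulmx1 mul0mx.
  have [j wj] : exists j, (v *m U ^t*) 0 j != 0.
    apply/existsP; apply: contraNT w0; rewrite negb_exists => /forallP H.
    by apply/eqP/rowP => j; rewrite [RHS]mxE; apply/eqP; have := H j; rewrite negbK.
  exists j; have : v *m U ^t* *m diag_mx (\row_j f j) = a *: (v *m U ^t*).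
    rewrite -(udiagK f UU) scalemxAl -vE !mulmxA -(mulmxA v).
    by rewrite (unitary_adjl UU) mulmx1.
  move=> /matrixP /(_ 0 j); rewrite mul_mx_diag !mxE mulrC => /esym.
  by apply: mulIf; move: wj; rewrite !mxE.
move=> [j ->]; apply/eigenvalueP; exists (row j U).
  by rewrite -row_mul (mul_udiag _ UU) row_mul row_diag_mx mxE -scalemxAl -rowE.
apply/eqP => /(congr1 (mulmx^~ (U ^t*))); rewrite -row_mul UU mul0mx.
by move=> /rowP /(_ j); rewrite !mxE eqxx => /eqP; rewrite oner_eq0.
Qed.

(** Makes the multiset of the [f j] an invariant of the matrix, which allows two different
    diagonalizations to be compared. *)
Lemma char_poly_udiag U f : U *m U ^t* = 1%:M ->
  char_poly (udiag U f) = \prod_j ('X - (f j)%:P).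
Proof.
move=> UU.
have UV := unitary_adjl UU.
have -> : char_poly (udiag U f) = char_poly (diag_mx (\row_j f j)).
  rewrite /char_poly.
  have -> : char_poly_mx (udiag U f) =
      map_mx polyC (U ^t*) *m char_poly_mx (diag_mx (\row_j f j)) *m map_mx polyC U.
    rewrite /char_poly_mx mulmxBr mulmxBl -!map_mxM udiag_row.
    rewrite mul_mx_scalar -scalemxAl -map_mxM UV map_mx1 scalemx1.
    by congr (_ - map_mx _ _); apply: eq_udiag => j; rewrite mxE.
  rewrite !det_mulmx mulrAC -det_mulmx -map_mxM UV map_mx1 det1.
  exact: mul1r.
rewrite char_poly_trig ?diag_mx_is_trig//.
by apply: eq_bigr => j _; rewrite !mxE eqxx mulr1n.
Qed.

End UnitaryDiagonalization.

(** * Estimates for exponentials and for powers of unitary matrices *)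

Section ExpEstimates.
Variables (R : realType) (n : nat).
Implicit Types A B X Y u v w : 'M[Cplx R]_n.

(** Stands in for letting [e] tend to 0 in an inequality with an error of order [e]. *)
Lemma small_le0 (x K e0 : R) : 0 < e0 -> 0 <= K ->
  (forall e, 0 < e -> e <= e0 -> x <= e * K) -> x <= 0.
Proof.
move=> e00 K0 H; rewrite leNgt; apply/negP => x0.
pose e := Num.min e0 (x / (2 * (K + 1))).
have d0 : 0 < x / (2 * (K + 1)) by rewrite divr_gt0// mulr_gt0//; lra.
have e_gt0 : 0 < e by rewrite lt_min e00.
have ee0 : e <= e0 by rewrite ge_min lexx.
have ed : e <= x / (2 * (K + 1)) by rewrite ge_min lexx orbT.
have := H e e_gt0 ee0.
move: ed; rewrite ler_pdivlMr; last by rewrite mulr_gt0//; lra.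
nra.
Qed.

(** From [1 - r <= expR (- r)] one gets [expR r * (1 - r) <= 1], hence
    [expR r - 1 <= r / (1 - r) <= 2 * r]. *)
Lemma expR_le_2 (r : R) : 0 <= r -> r <= 1 / 2 -> expR r - 1 <= 2 * r.
Proof.
move=> r0 r1; have := expR_ge1Dx (- r); rewrite expRN => H.
have e0 := expR_gt0 r.
have : expR r * (1 - r) <= 1 by rewrite mulrC -ler_pdivlMr// mul1r.
nra.
Qed.

Lemma expmx_taylor X : nm X <= 1 / 2 -> nm (expmx X - 1%:M - X) <= 2 * nm X ^+ 2.
Proof.
move=> X1; have X0 := nm_ge0 X.
have := @nm_expmx_dist R n X 0 (nm X) (lexx _).
rewrite nm0 expmx0 subr0 => /(_ X0) /le_trans; apply.
by have := expR_le_2 X0 X1; rewrite expr2; nra.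
Qed.

Lemma nm_expmx_sub1 X : nm X <= 1 / 2 -> nm (expmx X - 1%:M) <= 2 * nm X.
Proof.
move=> X1; have X0 := nm_ge0 X; have := expmx_taylor X1.
have := nmD (expmx X - 1%:M - X) X; rewrite subrK; nra.
Qed.

Lemma nm_expmx_lip X Y r : nm X <= r -> nm Y <= r ->
  nm (expmx X - expmx Y) <= expR r * nm (X - Y).
Proof.
move=> Xr Yr; have := nm_expmx_dist Xr Yr.
by have := nmD (expmx X - expmx Y - (X - Y)) (X - Y); rewrite subrK; lra.
Qed.

Lemma continuous_expmx : continuous (@expmx R n).
Proof.
move=> X; apply: (@cvg_nmP R n _ (nbhs X) (@expmx R n) _ _).2 => e e0.
pose K := expR (nm X + 1); have K0 : 0 < K := expR_gt0 _.
pose d := Num.min 1 (e / (2 * K)).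
have d0 : 0 < d by rewrite lt_min ltr01 divr_gt0// mulr_gt0.
near=> Y.
have Yd : nm (Y - X) < d by near: Y; exact: near_nm.
have d1 : d <= 1 by rewrite ge_min lexx.
have de : d <= e / (2 * K) by rewrite ge_min lexx orbT.
have YX : nm Y <= nm X + 1.
  by have := nmD (Y - X) X; rewrite subrK; lra.
have XX : nm X <= nm X + 1 by lra.
apply: (le_lt_trans (nm_expmx_lip YX XX)); rewrite -/K.
move: de; rewrite ler_pdivlMr ?mulr_gt0//; nra.
Unshelve. all: by end_near. Qed.

Definition unitaryP A : Prop := A *m A ^t* = 1%:M.

Lemma unitaryP_mul A B : unitaryP A -> unitaryP B -> unitaryP (A *m B).
Proof.
rewrite /unitaryP => AU BU; rewrite adjM mulmxA -(mulmxA A) BU mulmx1.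
exact: AU.
Qed.

Lemma unitaryP_one : unitaryP 1%:M.
Proof. by rewrite /unitaryP mul1mx trmx1 map_mx1. Qed.

Lemma unitaryP_exp A k : unitaryP A -> unitaryP (A ^+ k).
Proof.
move=> AU; elim: k => [|k IH]; first exact: unitaryP_one.
by rewrite mx_exprS; exact: unitaryP_mul.
Qed.

(** The bound must be linear in [k], but [nm] is not invariant under unitary factors. The induction
    therefore carries an arbitrary unitary [w] on the left, so that the products of unitary matrices
    around [u - v] are each bounded once instead of factor by factor. *)
Lemma unitary_pow_dist u v k : unitaryP u -> unitaryP v ->
  nm (u ^+ k - v ^+ k) <= k%:R * (unitary_bound R n ^+ 2 * nm (u - v)).
Proof.
move=> uU vU; set C := unitary_bound R n; set d := nm (u - v).
suff H w : unitaryP w -> nm (w *m (u ^+ k - v ^+ k)) <= k%:R * (C ^+ 2 * d).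
  by have := H _ unitaryP_one; rewrite mul1mx.
elim: k w => [|k IH] w wU; first by rewrite subrr mulmx0 nm0 mul0r.
have -> : w *m (u ^+ k.+1 - v ^+ k.+1) =
    (w *m u) *m (u ^+ k - v ^+ k) + w *m (u - v) *m v ^+ k.
  by rewrite !mx_exprS !mulmxBr !mulmxBl !mulmxA addrA subrK.
apply: (le_trans (nmD _ _)).
rewrite -[k.+1]addn1 natrD mulrDl mul1r; apply: lerD.
  by apply: IH; exact: unitaryP_mul.
have C0 : 0 <= C := ltW (unitary_bound_gt0 R n).
have d0 : 0 <= d := nm_ge0 _.
have wC : nm w <= C := nm_unitary wU.
have vC : nm (v ^+ k) <= C := nm_unitary (unitaryP_exp k vU).
apply: (le_trans (nmM _ _)); rewrite expr2 mulrAC; apply: ler_pM => //.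
  exact: nm_ge0.
  exact: nm_ge0.
by apply: (le_trans (nmM _ _)); rewrite -/d ler_wpM2r.
Qed.

End ExpEstimates.

(** * The Lie algebra of a closed unitary group *)

Section LieAlgebra.
Variables (R : realType) (n : nat) (G : set 'M[Cplx R]_n).
Hypothesis G_unitary : G `<=` unitary_group R n.
Hypothesis G_subgroup : subgroup_of_GL G.
Hypothesis G_closed_GL : closed_in_GL G.
Local Notation g := (lie_algebra G).
Implicit Types A B X Y Z u : 'M[Cplx R]_n.

Lemma nm_dist_triangler B A X : nm (A - X) <= nm (A - B) + nm (X - B).
Proof. by rewrite (nm_distC X); exact: nm_dist_triangle. Qed.

Lemma group_unitary A : G A -> unitaryP A.
Proof. by move=> /G_unitary /unitarymxP. Qed.

Lemma group_one : G 1%:M.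
Proof. by case: G_subgroup. Qed.

Lemma group_mul A B : G A -> G B -> G (A *m B).
Proof. by case: G_subgroup => _ _ H _; exact: H. Qed.

Lemma group_adj A : G A -> G (A ^t*).
Proof.
move=> GA; rewrite -invmx_unitary; last exact: G_unitary.
by case: G_subgroup => _ _ _; exact.
Qed.

Lemma group_exp A k : G A -> G (A ^+ k).
Proof.
move=> GA; elim: k => [|k IH]; first exact: group_one.
by rewrite mx_exprS; exact: group_mul.
Qed.

Lemma nm_group A : G A -> nm A <= unitary_bound R n.
Proof. by move=> /group_unitary; exact: nm_unitary. Qed.

Lemma unitaryP_approx A :
  (forall e : R, 0 < e -> exists2 B, G B & nm (B - A) < e) -> unitaryP A.
Proof.
move=> H; apply/eqP; rewrite -subr_eq0; apply/eqP/nm_eq0/le_anti.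
rewrite nm_ge0 andbT; have A0 := nm_ge0 A; have C0 := unitary_bound_gt0 R n.
apply: (@small_le0 _ _ (nm A + unitary_bound R n) 1) => //; first by lra.
move=> e e0 _; have [B GB BA] := H e e0.
have BU := group_unitary GB; have BC := nm_group GB.
have -> : A *m A ^t* - 1%:M = (A - B) *m A ^t* + B *m (A - B) ^t*.
  rewrite -BU (_ : (A - B) ^t* = A ^t* - B ^t*).
    by rewrite mulmxBl mulmxBr addrA subrK.
  by rewrite raddfB /= map_mxB.
rewrite mulrDr; apply: (le_trans (nmD _ _)); apply: lerD; apply: (le_trans (nmM _ _)).
  by rewrite nm_conj nm_distC ler_wpM2r// ltW.
rewrite nm_conj nm_distC mulrC; apply: ler_pM; rewrite ?nm_ge0//.
by rewrite nm_distC nm_distC ltW.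
Qed.

(** Closedness in [GL] becomes closedness among all matrices: a limit of unitary matrices is
    unitary, hence invertible. *)
Lemma group_approx A :
  (forall e : R, 0 < e -> exists2 B, G B & nm (B - A) < e) -> G A.
Proof.
move=> H; have AU := unitaryP_approx H.
case: G_closed_GL => F /closed_nm cF GF; rewrite GF; split.
  by apply: cF => e /H [B]; rewrite {1}GF => -[FB _] BA; exists B.
by apply: unitarymx_unit; apply/unitarymxP.
Qed.

Lemma subgroup_is_closed : closed G.
Proof. by apply/closed_nm; exact: group_approx. Qed.

Lemma lie_exp1 X : g X -> G (expmx X).
Proof. by move=> /(_ 1); rewrite of_real1 scale1r. Qed.

Lemma lie_scale X (a : R) : g X -> g (of_real a *: X).
Proof. by move=> gX t; rewrite scalerA -of_realM; exact: gX. Qed.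

Lemma lie_opp X : g X -> g (- X).
Proof.
by move=> gX; have := @lie_scale X (-1) gX; rewrite of_realN of_real1 scaleN1r.
Qed.

Lemma lie_zero : g 0.
Proof. by move=> t; rewrite scaler0 expmx0; exact: group_one. Qed.

Lemma adjD A B : (A + B) ^t* = A ^t* + B ^t*.
Proof. by rewrite raddfD /= map_mxD. Qed.

Lemma adj1 : (1%:M : 'M[Cplx R]_n) ^t* = 1%:M.
Proof. by rewrite trmx1 map_mx1. Qed.

Lemma adjZ (a : R) A : (of_real a *: A) ^t* = of_real a *: A ^t*.
Proof.
apply/matrixP => i j; rewrite !mxE rmorphM /=.
by congr (_ * _); exact: conj_of_real.
Qed.

(** Elements [u = 1 + eps Y + o(eps)] of [G] exist for arbitrarily small [eps]; [eta] bounds both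
    [eps] and the relative error. This is easier to verify than membership in [g], to which
    [lie_tangent] and [lie_is_tangent] show it equivalent. *)
Definition tangent Y := forall eta : R, 0 < eta -> exists u (eps : R),
  [/\ G u, 0 < eps, eps < eta & nm (u - 1%:M - of_real eps *: Y) <= eta * eps].

Lemma tangent_skew Y : tangent Y -> Y ^t* = - Y.
Proof.
move=> H; apply/eqP; rewrite -subr_eq0 opprK; apply/eqP/nm_eq0/le_anti.
rewrite nm_ge0 andbT; set y := nm Y; have y0 : 0 <= y := nm_ge0 Y.
have K0 : 0 <= (y + 1) ^+ 2 + 2 by rewrite addr_ge0// sqr_ge0.
apply: (small_le0 ltr01 K0) => eta eta0 eta1.
have [u [e [/group_unitary uU e0 ee]]] := H eta eta0.
set D := u - 1%:M; set P := D - _ => Pe.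
have DE : D = of_real e *: Y + P by rewrite /P [RHS]addrC subrK.
(* Unitarity of [u = 1 + D]: the left side is of first order in [e], the right side of second
   order. *)
have DD : D + D ^t* = - (D *m D ^t*).
  have uE : u = 1%:M + D by rewrite /D addrC subrK.
  move: uU; rewrite /unitaryP {1 2}uE adjD adj1.
  rewrite mulmxDl mul1mx mulmxDr mulmx1 -addrA => /(canRL (addKr _)).
  rewrite addNr addrA [_ + D]addrC => /eqP.
  by rewrite addr_eq0 => /eqP.
have : of_real e *: (Y + Y ^t*) = - (D *m D ^t* + (P + P ^t*)).
  rewrite opprD -DD {1 2}DE adjD adjZ scalerDr addrACA addrK.
  exact: erefl.
move=> /(congr1 (@nm R n)); rewrite nmN nmZ (gtr0_norm e0) addrC => YE.
have nD : nm D <= e * (y + 1).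
  rewrite DE; apply: (le_trans (nmD _ _)); rewrite nmZ (gtr0_norm e0) mulrDr.
  rewrite lerD2l; apply: le_trans Pe _; rewrite mulrC.
  by apply: ler_wpM2l => //; exact: ltW.
have : e * nm (Y ^t* + Y) <= e * (eta * ((y + 1) ^+ 2 + 2)).
  rewrite YE; apply: (@le_trans _ _ ((e * (y + 1)) ^+ 2 + (eta * e + eta * e))).
    apply: (le_trans (nmD _ _)); apply: lerD.
      apply: (le_trans (nmM _ _)); rewrite nm_conj expr2.
      by apply: ler_pM; rewrite ?nm_ge0.
    by apply: (le_trans (nmD _ _)); rewrite nm_conj; apply: lerD.
  have -> : e * (eta * ((y + 1) ^+ 2 + 2)) =
     e * (eta * (y + 1) ^+ 2) + (eta * e + eta * e) by ring.
  rewrite lerD2r exprMn expr2 -mulrA.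
  by apply: ler_wpM2l; [exact: ltW|apply: ler_wpM2r; [exact: sqr_ge0|exact: ltW]].
by rewrite (ler_pM2l e0).
Qed.

Lemma lie_is_tangent X : g X -> tangent X.
Proof.
move=> gX eta eta0; pose x := nm X; have x0 : 0 <= x := nm_ge0 X.
(* The first bound makes the Taylor remainder [2 * (e * x) ^+ 2] at most [eta * e]; the second puts
   [e X] in the range of [expmx_taylor]. *)
pose e := Num.min (eta / (2 * (x ^+ 2 + 1))) (1 / (2 * (x + 1))).
have x20 := sqr_ge0 x.
have e0 : 0 < e by rewrite lt_min !divr_gt0// mulr_gt0//; lra.
have e1 : e <= eta / (2 * (x ^+ 2 + 1)) by rewrite ge_min lexx.
have e2 : e <= 1 / (2 * (x + 1)) by rewrite ge_min lexx orbT.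
move: e1 e2; rewrite !ler_pdivlMr; try by rewrite mulr_gt0//; lra.
move=> e1 e2; exists (expmx (of_real e *: X)), e; split; [exact: gX|exact: e0|nra|].
have nX : nm (of_real e *: X) = e * x by rewrite nmZ gtr0_norm.
have nX2 : nm (of_real e *: X) <= 1 / 2 by rewrite nX; nra.
apply: (le_trans (expmx_taylor nX2)); rewrite nX exprMn.
move: e1; set x2 := x ^+ 2 => e1; rewrite expr2; nra.
Qed.

Lemma lie_skew X : g X -> X ^t* = - X.
Proof. by move=> /lie_is_tangent /tangent_skew. Qed.

Lemma lie_exp_adj X : g X -> (expmx X) ^t* = expmx (- X).
Proof. by move=> /lie_skew; exact: expmx_skew_adj. Qed.

Lemma lie_closed : closed g.
Proof.
apply/closed_nm => X H t; apply: group_approx => e e0.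
have /(cvg_nmP _ _ _).1 /(_ e e0) := @continuous_expmx R n (of_real t *: X).
move=> /nbhs_nmP [d d0 Hd].
have [Y gY YX] := H (d / (`|t| + 1)) ltac:(by rewrite divr_gt0// ltr_wpDl).
exists (expmx (of_real t *: Y)); first exact: gY.
apply: Hd; rewrite -scalerBr nmZ.
have t1 : 0 < `|t| + 1 by rewrite ltr_wpDl.
move: YX; rewrite ltr_pdivlMr//; have := nm_ge0 (Y - X); nra.
Qed.

(* Powers u^m of elements of G that approach the identity tangentially to Y
   converge to exp (t Y) when m eps tends to t. *)
Lemma lie_tangent Y : tangent Y -> g Y.
Proof.
move=> H; have skY := tangent_skew H.
have Hpos (t : R) : 0 <= t -> G (expmx (of_real t *: Y)).
  move=> t0; apply: group_approx => e e0.
  pose C := unitary_bound R n; have C0 : 0 < C := unitary_bound_gt0 R n.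
  pose y := nm Y; have y0 : 0 <= y := nm_ge0 Y.
  (* The total error will be at most [eta * K]. The first summand accounts for [m] factors [u], each
     within [eps * eta * (1 + 2 * y ^+ 2)] of [exp (eps Y)]; the second for the leftover time
     [t - m eps], which is at most [eps]. *)
  pose K := t * (C ^+ 2 * (1 + 2 * y ^+ 2)) + C * (2 * y).
  have K0 : 0 <= K.
    by rewrite addr_ge0// !mulr_ge0 ?sqr_ge0 ?addr_ge0 ?mulr_ge0 ?sqr_ge0// ltW.
  pose eta := Num.min (e / (K + 1)) (1 / (2 * (y + 1))).
  have eta0 : 0 < eta by rewrite lt_min !divr_gt0// ?mulr_gt0//; lra.
  have etae : eta <= e / (K + 1) by rewrite ge_min lexx.
  have etay : eta <= 1 / (2 * (y + 1)) by rewrite ge_min lexx orbT.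
  move: etay; rewrite ler_pdivlMr; last by rewrite mulr_gt0//; lra.
  move: etae; rewrite ler_pdivlMr; last by lra.
  move=> etae etay.
  have [u [eps [Gu eps0 epseta uY]]] := H eta eta0.
  pose m := Num.truncn (t / eps).
  have m_itv : m%:R * eps <= t < m.+1%:R * eps.
    have te0 : 0 <= t / eps by rewrite divr_ge0// ltW.
    have /andP[a b] := truncn_itv te0.
    by rewrite -ler_pdivlMr// -ltr_pdivrMr// a b.
  case/andP: m_itv => mt tm.
  have epsy : eps * y <= 1 / 2 by nra.
  pose v := expmx (of_real eps *: Y).
  have vU : unitaryP v by apply: expmx_skew_unitary; exact: skewZ.
  have nY : nm (of_real eps *: Y) = eps * y by rewrite nmZ gtr0_norm.
  have vY : nm (v - 1%:M - of_real eps *: Y) <= 2 * (eps * y) ^+ 2.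
    by rewrite -nY; apply: expmx_taylor; rewrite nY.
  have uv : nm (u - v) <= eps * eta * (1 + 2 * y ^+ 2).
    have -> : u - v = (u - 1%:M - of_real eps *: Y) - (v - 1%:M - of_real eps *: Y).
      by rewrite !opprB !addrA !subrK.
    apply: (le_trans (nmB _ _)).
    have : 2 * (eps * y) ^+ 2 <= eps * eta * (2 * y ^+ 2).
      have -> : 2 * (eps * y) ^+ 2 = eps * eps * (2 * y ^+ 2) by ring.
      by rewrite ler_wpM2r ?mulr_ge0 ?sqr_ge0//; apply: ler_wpM2l; exact: ltW.
    by rewrite mulrDr mulr1 [eps * eta]mulrC; lra.
  exists (u ^+ m); first exact: group_exp.
  have vm : v ^+ m = expmx (of_real (m%:R * eps) *: Y) by exact: expmx_skewX.
  have pow := unitary_pow_dist m (group_unitary Gu) vU.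
  pose s := t - m%:R * eps.
  have s0 : 0 <= s by rewrite subr_ge0.
  have se : s <= eps by move: tm; rewrite -[m.+1]addn1 natrD mulrDl mul1r /s; lra.
  have tail : nm (expmx (of_real t *: Y) - v ^+ m) <= C * (2 * (eps * y)).
    have -> : expmx (of_real t *: Y) =
        v ^+ m *m expmx (of_real s *: Y).
      have ts : m%:R * eps + s = t by rewrite /s addrC subrK.
      by rewrite vm (expmx_skewD _ _ skY) ts {vm}.
    rewrite -{2}(mulmx1 (v ^+ m)) -mulmxBr; apply: (le_trans (nmM _ _)).
    apply: ler_pM; rewrite ?nm_ge0//.
      by apply: nm_unitary; exact: unitaryP_exp.
    have nsY : nm (of_real s *: Y) = s * y by rewrite nmZ ger0_norm.
    have sy : s * y <= eps * y by rewrite ler_wpM2r.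
    have sY2 : nm (of_real s *: Y) <= 1 / 2 by rewrite nsY; exact: le_trans sy epsy.
    by apply: le_trans (nm_expmx_sub1 sY2) _; rewrite nsY ler_wpM2l.
  apply: (le_lt_trans (nm_dist_triangler (v ^+ m) _ _)).
  have pow2 : nm (u ^+ m - v ^+ m) <= eta * (t * (C ^+ 2 * (1 + 2 * y ^+ 2))).
    apply: (le_trans pow); rewrite -/C.
    set q := 1 + 2 * y ^+ 2 in uv *.
    have q0 : 0 <= q by rewrite addr_ge0// mulr_ge0// sqr_ge0.
    have -> : eta * (t * (C ^+ 2 * q)) = t * (C ^+ 2 * (eta * q)) by ring.
    apply: (@le_trans _ _ (m%:R * (C ^+ 2 * (eps * eta * q)))).
      by rewrite ler_wpM2l// ler_wpM2l ?sqr_ge0.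
    have -> : m%:R * (C ^+ 2 * (eps * eta * q)) = (m%:R * eps) * (C ^+ 2 * (eta * q)).
      by ring.
    by rewrite ler_wpM2r// !mulr_ge0 ?sqr_ge0// ltW.
  have tail2 : C * (2 * (eps * y)) <= eta * (C * (2 * y)).
    have -> : C * (2 * (eps * y)) = eps * (C * (2 * y)) by ring.
    by rewrite ler_wpM2r ?mulr_ge0// ltW.
  have KE : eta * K = eta * (t * (C ^+ 2 * (1 + 2 * y ^+ 2))) + eta * (C * (2 * y)).
    by rewrite -mulrDr.
  have Ke : eta * K < e by nra.
  by apply: le_lt_trans (lerD pow2 (le_trans tail tail2)) _; rewrite -KE.
(* Negative times are reached by taking adjoints, which invert the elements of [G]. *)
move=> t; have [t0|t0] := leP 0 t; first exact: Hpos.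
have := group_adj (Hpos (- t) ltac:(by rewrite oppr_ge0 ltW)).
rewrite expmx_skew_adj; last exact: skewZ.
by rewrite of_realN scaleNr opprK {Hpos H}.
Qed.

(** The product [exp (eps X) exp (eps Y)] lies in [G] and equals [1 + eps (X + Y)] up to
    [K * eps ^+ 2], so [X + Y] is tangent. *)
Lemma lie_add X Y : g X -> g Y -> g (X + Y).
Proof.
move=> gX gY; apply: lie_tangent => eta eta0.
pose C := unitary_bound R n; have C0 : 0 < C := unitary_bound_gt0 R n.
pose x := nm X; have x0 : 0 <= x := nm_ge0 X.
pose y := nm Y; have y0 : 0 <= y := nm_ge0 Y.
pose K := 2 * x ^+ 2 * C + x * (2 * y) + 2 * y ^+ 2.
have K0 : 0 <= K.
  by rewrite !addr_ge0// !mulr_ge0 ?sqr_ge0// ltW.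
pose eps := Num.min (eta / 2) (Num.min (eta / (K + 1)) (1 / (2 * (x + y + 1)))).
have eps0 : 0 < eps by rewrite !lt_min !divr_gt0// ?mulr_gt0//; lra.
have e1 : eps <= eta / 2 by rewrite ge_min lexx.
have e2 : eps <= eta / (K + 1) by rewrite !ge_min lexx orbT.
have e3 : eps <= 1 / (2 * (x + y + 1)) by rewrite !ge_min lexx !orbT.
move: e3; rewrite ler_pdivlMr; last by rewrite mulr_gt0//; lra.
move: e2; rewrite ler_pdivlMr; last by lra.
move=> e2 e3.
pose a := expmx (of_real eps *: X); pose b := expmx (of_real eps *: Y).
exists (a *m b), eps; split => //; first by apply: group_mul; [exact: gX|exact: gY].
  lra.
have nX : nm (of_real eps *: X) = eps * x by rewrite nmZ gtr0_norm.
have nY : nm (of_real eps *: Y) = eps * y by rewrite nmZ gtr0_norm.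
have ex : eps * x <= 1 / 2 by nra.
have ey : eps * y <= 1 / 2 by nra.
have aX : nm (a - 1%:M - of_real eps *: X) <= 2 * (eps * x) ^+ 2.
  by rewrite -nX; apply: expmx_taylor; rewrite nX.
have bY : nm (b - 1%:M - of_real eps *: Y) <= 2 * (eps * y) ^+ 2.
  by rewrite -nY; apply: expmx_taylor; rewrite nY.
have b1 : nm (b - 1%:M) <= 2 * (eps * y).
  by rewrite -nY; apply: nm_expmx_sub1; rewrite nY.
have bC : nm b <= C by apply: nm_group; exact: gY.
move: nX nY aX bY b1 bC; rewrite scalerDr.
move: (of_real eps *: X) (of_real eps *: Y) a b => X' Y' a b nX nY aX bY b1 bC.
have -> : a *m b - 1%:M - (X' + Y') =
    (a - 1%:M - X') *m b + X' *m (b - 1%:M) + (b - 1%:M - Y').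
  rewrite mulmxBl mulmxBl mulmxBr mul1mx mulmx1 [_ + (X' *m b - X')]addrA subrK.
  rewrite opprD addrACA [_ - b - X']addrAC -[b - _ - _]addrA -[RHS]addrA.
  by rewrite [- b + _]addKr.
apply: (le_trans (nmD _ _)).
have H1 : nm ((a - 1%:M - X') *m b + X' *m (b - 1%:M)) <=
    2 * (eps * x) ^+ 2 * C + eps * x * (2 * (eps * y)).
  apply: (le_trans (nmD _ _)); apply: lerD; apply: (le_trans (nmM _ _)).
    by apply: ler_pM; rewrite ?nm_ge0.
  by rewrite nX; apply: ler_wpM2l => //; rewrite mulr_ge0// ltW.
apply: (le_trans (lerD H1 bY)).
have -> : 2 * (eps * x) ^+ 2 * C + eps * x * (2 * (eps * y)) + 2 * (eps * y) ^+ 2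
   = (eps * K) * eps by rewrite /K; ring.
by rewrite ler_wpM2r ?ltW//; nra.
Qed.

Lemma lie_sub X Y : g X -> g Y -> g (X - Y).
Proof. by move=> gX gY; exact: (lie_add gX (lie_opp gY)). Qed.

Lemma lie_sum I (r : seq I) (F : I -> 'M[Cplx R]_n) :
  (forall i, g (F i)) -> g (\sum_(i <- r) F i).
Proof.
move=> gF; elim/big_ind: _; [exact: lie_zero|exact: lie_add|].
by move=> i _; exact: gF.
Qed.

End LieAlgebra.

(** * Local surjectivity of the exponential *)

Lemma sub_split (V : zmodType) (m x y z : V) : m - z = (m - x - y) - (z - x - y).
Proof. by rewrite !opprB !addrA !subrK. Qed.

Section ClosedSubgroup.
Variables (R : realType) (n : nat) (G : set 'M[Cplx R]_n).
Hypothesis G_unitary : G `<=` unitary_group R n.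
Hypothesis G_subgroup : subgroup_of_GL G.
Hypothesis G_closed_GL : closed_in_GL G.
Local Notation g := (lie_algebra G).
Implicit Types A B X Y Z M u : 'M[Cplx R]_n.

Lemma continuous_dist_expmx M : continuous (fun X => nm (M - expmx X)).
Proof.
apply: continuous_nm => X.
apply: (@cvg_nmP R n _ (nbhs X) (fun X => M - expmx X) _ _).2 => e e0.
have /(cvg_nmP _ _ _).1 /(_ e e0) := @continuous_expmx R n X.
apply: filterS => Y; rewrite nm_distC => YX.
by rewrite opprB addrC addrA subrK.
Qed.

Lemma closest_exp (r : R) M : 0 <= r -> exists2 X, g X /\ nm X <= r &
  forall Y, g Y -> nm Y <= r -> nm (M - expmx X) <= nm (M - expmx Y).
Proof.
move=> r0; pose K := [set X : 'M[Cplx R]_n | nm X <= r] `&` g.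
have cK : compact K.
  apply: compact_closedI; first exact: compact_nm_le.
  exact: (lie_closed G_unitary G_closed_GL).
have K0 : K !=set0.
  by exists 0; split; [rewrite /= nm0|exact: (lie_zero G_subgroup)].
have [X XK Xmin] := compact_EVT_min K0 cK
  (continuous_subspaceT (@continuous_dist_expmx M)).
exists X; first by move: XK; rewrite inE => -[].
by move=> Y gY Yr; apply: Xmin; rewrite inE.
Qed.

(* Cartan's argument: for M close to 1, let exp X be a point of exp g closest to
   M. If M <> exp X for a sequence of M tending to 1, the unit vectors in the
   direction of M - exp X accumulate at some Y, tangent to G, hence in g; then
   exp (X + |M - exp X| Y) is closer to M than exp X. *)
Lemma exp_local_onto (r : R) : 0 < r -> r <= 1 / 4 ->
  exists2 rho : R, 0 < rho & forall M, G M -> nm (M - 1%:M) < rho ->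
    exists X, [/\ g X, nm X <= r & expmx X = M].
Proof.
move=> r0 r4; apply: contrapT => H.
pose rho (k : nat) : R := k.+1%:R^-1.
have rho0 k : 0 < rho k by rewrite invr_gt0 ltr0n.
have rho_small (e : R) : 0 < e -> exists N, forall k, (N <= k)%N -> rho k < e.
  move=> e0; exists (Num.truncn e^-1) => k Nk; rewrite /rho.
  rewrite invf_plt ?posrE ?ltr0n//; apply: (lt_le_trans (truncnS_gt _)).
  by rewrite ler_nat.
have Hk k : exists M X, [/\ G M, nm (M - 1%:M) < rho k, g X /\ nm X <= r,
    0 < nm (M - expmx X)
    & forall Y, g Y -> nm Y <= r -> nm (M - expmx X) <= nm (M - expmx Y)].
  apply: contrapT => Hk; apply: H; exists (rho k) => // M GM M1.
  apply: contrapT => HM; apply: Hk.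
  have [X [gX Xr] Xmin] := closest_exp M (ltW r0).
  exists M, X; split; [exact: GM|exact: M1|by split| |exact: Xmin].
  apply: nm_gt0; apply/eqP => MX; apply: HM; exists X; split; [exact: gX|exact: Xr|].
  by move/eqP: MX; rewrite subr_eq0 => /eqP.
have [M HM] := choice Hk; have [X HX] := choice HM; clear H Hk HM.
have [eps epsE] : exists eps : nat -> R, forall k, nm (M k - expmx (X k)) = eps k.
  by exists (fun k => nm (M k - expmx (X k))).
have GM k : G (M k) by have [H _ _ _ _] := HX k; exact: H.
have M1 k : nm (M k - 1%:M) < rho k by have [_ H _ _ _] := HX k; exact: H.
have gX k : g (X k) by have [_ _ [H _] _ _] := HX k; exact: H.
have Xr k : nm (X k) <= r by have [_ _ [_ H] _ _] := HX k; exact: H.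
have eps0 k : 0 < eps k by have [_ _ _ H _] := HX k; rewrite -epsE; exact: H.
have Xmin k Y : g Y -> nm Y <= r -> eps k <= nm (M k - expmx Y).
  by have [_ _ _ _ H] := HX k; rewrite -epsE; exact: H.
clear HX.
(* Minimality is compared with the competitor [Y = 0], whose exponential is 1. *)
have eps_rho k : eps k < rho k.
  apply: le_lt_trans (M1 k).
  have := Xmin k 0 (lie_zero G_subgroup); rewrite nm0 expmx0; apply; exact: ltW.
(* Here [r <= 1 / 4] matters: the Taylor remainder [2 * nm (X k) ^+ 2] is then at most half of
   [nm (X k)], and the other half is at most [nm (expmx (X k) - 1) <= 2 * rho k]. *)
have X_rho k : nm (X k) <= 4 * rho k.
  have x0 := nm_ge0 (X k).
  have X2 : nm (X k) <= 1 / 2 by have := Xr k; lra.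
  have T := expmx_taylor X2.
  have D1 : nm (X k) <= nm (expmx (X k) - 1%:M) + nm (expmx (X k) - 1%:M - X k).
    have := nmB (expmx (X k) - 1%:M) (expmx (X k) - 1%:M - X k).
    by rewrite opprB addrC subrK.
  have D2 := nm_dist_triangle (M k) (expmx (X k)) 1%:M.
  rewrite (nm_distC (expmx (X k)) (M k)) in D2.
  have D3 := eps_rho k; rewrite -epsE in D3; have D4 := M1 k; have D5 := Xr k.
  move: T D1 D2 D3 D4 D5 x0 X2.
  set a := nm (X k); set b := nm (expmx _ - _ - _); set c := nm (expmx _ - _).
  by set d := nm (M k - expmx _); move=> *; nra.
pose D k := of_real (eps k)^-1 *: (M k - expmx (X k)).
have DE k : M k - expmx (X k) = of_real (eps k) *: D k.
  by rewrite scalerA -of_realM mulfV ?gt_eqF// of_real1 scale1r.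
have nD k : nm (D k) = 1.
  by rewrite nmZ ger0_norm ?invr_ge0 ?ltW// epsE mulVf ?gt_eqF.
have nD1 k : nm (D k) <= 1 by rewrite nD.
have [Y clY] := nm_cluster nD1.
have close (e e' : R) : 0 < e -> 0 < e' -> exists2 k, rho k < e & nm (D k - Y) < e'.
  move=> e0 e'0; have [N HN] := rho_small e e0.
  by have [k Nk kY] := clY e' N e'0; exists k => //; exact: HN.
have nY : nm Y <= 2.
  have [k _ kY] := close 1 1 ltr01 ltr01.
  have := nmB (D k) (D k - Y); rewrite opprB addrC subrK nD => H.
  by apply: (le_trans H); lra.
have gY : g Y.
  apply: (lie_tangent G_unitary G_subgroup G_closed_GL) => eta eta0.
  have [||k k1 k2] := close (Num.min (eta / 16) (1 / 16)) (eta / 2).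
  - by rewrite lt_min; apply/andP; split; lra.
  - by lra.
  move: k1; rewrite lt_min => /andP[k1 k1'].
  have nX : nm (- X k) <= 1 / 2 by rewrite nmN; have := X_rho k; lra.
  exists (expmx (- X k) *m M k), (eps k); split.
  - apply: (group_mul G_subgroup); last exact: GM.
    by apply: lie_exp1; apply: lie_opp; exact: gX.
  - exact: eps0.
  - by have := eps_rho k; lra.
  have -> : expmx (- X k) *m M k - 1%:M - of_real (eps k) *: Y =
      of_real (eps k) *: ((expmx (- X k) - 1%:M) *m D k + (D k - Y)).
    rewrite mulmxBl mul1mx addrA subrK scalerBr scalemxAr -DE mulmxBr.
    have skX := lie_skew G_unitary (gX k).
    rewrite -(expmx_skew_adj skX); congr (_ - _ - _).
    exact/esym/unitary_adjl/(expmx_skew_unitary skX).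
  rewrite nmZ (gtr0_norm (eps0 k)) mulrC ler_pM2r//.
  apply: (le_trans (nmD _ _)).
  have H1 := nm_expmx_sub1 nX; rewrite nmN in H1.
  have H2 := nmM (expmx (- X k) - 1%:M) (D k); rewrite nD mulr1 in H2.
  by have H3 := X_rho k; lra.
(* The improved competitor [Z] has norm at most [6 * rho k], so [r / 6] keeps it in the ball. The
   error of linearizing [exp] is at most [24 * rho k * eps k], and [1 / 96] makes it [eps k / 4].
   With another [eps k / 4] from replacing [D k] by [Y], the distance is halved. *)
have [||k k1 k2] := close (Num.min (r / 6) (1 / 96)) (1 / 4).
- by rewrite lt_min; apply/andP; split; lra.
- by lra.
move: k1; rewrite lt_min => /andP[k1 k1'].
have epsk := eps_rho k; have Xk := X_rho k; have ek := eps0 k.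
pose Z := X k + of_real (eps k) *: Y.
have nZ : nm Z <= 6 * rho k.
  apply: (le_trans (nmD _ _)); rewrite nmZ (gtr0_norm ek); nra.
have gZ : g Z.
  by apply: (lie_add G_unitary G_subgroup G_closed_GL); [exact: gX|exact: lie_scale].
have nX6 : nm (X k) <= 6 * rho k by have := rho0 k; lra.
have := nm_expmx_dist nZ nX6.
have -> : Z - X k = of_real (eps k) *: Y by rewrite /Z addrC addKr.
rewrite nmZ (gtr0_norm ek) => dist.
have er : expR (6 * rho k) - 1 <= 2 * (6 * rho k).
  by apply: expR_le_2; [have := rho0 k|]; lra.
have : nm (M k - expmx Z) <= eps k * (1 / 2).
  have -> : M k - expmx Z = of_real (eps k) *: (D k - Y) -
      (expmx Z - expmx (X k) - of_real (eps k) *: Y).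
    rewrite scalerBr -DE; exact: sub_split.
  apply: (le_trans (nmB _ _)); rewrite nmZ (gtr0_norm ek).
  have H1 : eps k * nm (D k - Y) <= eps k * (1 / 4) by rewrite ler_pM2l// ltW.
  have H2 : (expR (6 * rho k) - 1) * (eps k * nm Y) <= eps k * (1 / 4).
    have -> : (expR (6 * rho k) - 1) * (eps k * nm Y) =
       eps k * ((expR (6 * rho k) - 1) * nm Y) by ring.
    rewrite ler_pM2l//; have y0 := nm_ge0 Y; have r1 := rho0 k.
    have e0 : 0 <= expR (6 * rho k) - 1 by have := expR_ge1Dx (6 * rho k); lra.
    by apply: (@le_trans _ _ (2 * (6 * rho k) * 2)); [apply: ler_pM|lra].
  have -> : eps k * (1 / 2) = eps k * (1 / 4) + eps k * (1 / 4) by lra.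
  by apply: lerD => //; exact: le_trans dist H2.
have Zr : nm Z <= r by lra.
by have := Xmin k Z gZ Zr; lra.
Qed.

End ClosedSubgroup.

(** * Odd functional calculus *)

Section OddFunctionalCalculus.
Variables (R : realType) (n : nat) (G : set 'M[Cplx R]_n).
Hypothesis G_unitary : G `<=` unitary_group R n.
Hypothesis G_subgroup : subgroup_of_GL G.
Hypothesis G_closed_GL : closed_in_GL G.
Hypothesis G_svd : svd_closed_algebra (lie_algebra G).
Local Notation g := (lie_algebra G).

Variables (U : 'M[Cplx R]_n) (t : 'I_n -> R).
Hypothesis UU : U *m U ^t* = 1%:M.
Hypothesis gX : g (udiag U (fun j => imag (t j))).

Definition singular_values : seq R :=
  sort >=%O (undup [seq `|t j| | j <- enum 'I_n & t j != 0]).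
Local Notation S := singular_values.

Definition singular_value (k : 'I_(size S)) : R := nth 0 S k.

Definition singular_component (k : 'I_(size S)) : 'M[Cplx R]_n :=
  udiag U (fun j => if `|t j| == singular_value k then imag (Num.sg (t j)) else 0).

Lemma mem_singular_values x :
  x \in S -> exists2 j, x = `|t j| & t j != 0.
Proof.
rewrite mem_sort mem_undup => /mapP [j]; rewrite mem_filter => /andP[tj _] ->.
by exists j.
Qed.

Lemma singular_value_gt0 k : 0 < singular_value k.
Proof.
have /mem_singular_values [j jE tj] := mem_nth 0 (ltn_ord k).
by rewrite /singular_value jE normr_gt0.
Qed.

Lemma singular_values_uniq : uniq S.
Proof. by rewrite sort_uniq undup_uniq. Qed.

Lemma singular_value_inj : injective singular_value.
Proof.
move=> h k /eqP; rewrite /singular_value nth_uniq ?singular_values_uniq//.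
by move=> /eqP; exact: val_inj.
Qed.

Lemma singular_value_decr (h k : 'I_(size S)) :
  (h < k)%N -> singular_value k < singular_value h.
Proof.
move=> hk; rewrite lt_neqAle; apply/andP; split.
  by apply: contraTneq hk => /singular_value_inj ->; rewrite ltnn.
have sS : sorted >=%O S by apply: sort_sorted => x y; exact: le_total.
have tr : transitive (>=%O : rel R) by move=> y x z /= xy yz; exact: le_trans yz xy.
exact: (sorted_ltn_nth tr 0 sS _ _ (ltn_ord h) (ltn_ord k) hk).
Qed.

Lemma singular_value_ex j : t j != 0 -> exists k, singular_value k = `|t j|.
Proof.
move=> tj; have tS : `|t j| \in S.
  by rewrite mem_sort mem_undup; apply/mapP; exists j => //; rewrite mem_filter tj mem_enum.
have kS : (index `|t j|%R S < size S)%N by rewrite index_mem.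
by exists (Ordinal kS); rewrite /singular_value /= nth_index.
Qed.

(** At an index [j] with [t j != 0] only the component of [|t j|] contributes, with coefficient
    [phi |t j|] times the sign of [t j], which is [phi (t j)] by oddness. If [t j = 0] nothing
    contributes, in accordance with [phi 0 = 0]. The case [phi = id] recovers the matrix itself. *)
Lemma singular_sum (phi : R -> R) : (forall x, phi (- x) = - phi x) ->
  \sum_k of_real (phi (singular_value k)) *: singular_component k =
  udiag U (fun j => imag (phi (t j))).
Proof.
move=> phiN; have phi0 : phi 0 = 0 by have := phiN 0; rewrite oppr0; lra.
under eq_bigr do rewrite udiagZ.
rewrite udiag_sum; apply: eq_udiag => j.
have [tj|tj] := eqVneq (t j) 0.
  rewrite big1 ?tj ?phi0// => k _; rewrite normr0.
  by rewrite ifF ?mulr0//; apply/negbTE; rewrite eq_sym gt_eqF// singular_value_gt0.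
have [k0 k0E] := singular_value_ex tj.
rewrite (bigD1 k0)//= k0E eqxx big1 ?addr0 => [|k kk0]; last first.
  rewrite ifF ?mulr0//; apply/negbTE; rewrite -k0E.
  by apply: contra_neq kk0 => /singular_value_inj ->.
apply: Cplx_eqP; rewrite ?reM ?imM /= ?mulr0 ?mul0r ?subr0 ?addr0//.
case: (ltgtP (t j) 0) => [tj0|tj0|/eqP]; last by rewrite (negbTE tj).
  by rewrite ltr0_sg// ltr0_norm// phiN mulrN1 opprK.
by rewrite gtr0_sg// gtr0_norm// mulr1.
Qed.

Lemma singular_svd : udiag U (fun j => imag (t j)) != 0 ->
  svd_decomposition singular_value singular_component (udiag U (fun j => imag (t j))).
Proof.
move=> X0; split; last 1 first.
- by rewrite (@singular_sum id).
- split.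
  + rewrite lt0n; apply: contraNneq X0 => S0; rewrite -(udiag0 U).
    apply/eqP/eq_udiag => j; have [->//|tj] := eqVneq (t j) 0.
    by have [k _] := singular_value_ex tj; have := leq_ltn_trans (leq0n k) (ltn_ord k); rewrite S0.
  + move=> k; apply/eqP; rewrite -(udiag0 U) => /(udiag_inj UU).
    have /mem_singular_values [j jE tj] := mem_nth 0 (ltn_ord k).
    move=> /(_ j); rewrite /singular_value jE eqxx => /(congr1 im) /= /eqP.
    by rewrite sgr_eq0 (negbTE tj).
  + move=> h k hk; rewrite /singular_component udiag_adj udiag_adj.
    rewrite !(udiagM _ _ UU) -!(udiag0 U).
    have H j : `|t j| == singular_value h -> `|t j| == singular_value k = false.
      by move=> /eqP ->; apply/negbTE; apply: contra_neq hk => /singular_value_inj.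
    split; apply: eq_udiag => j; case: ifP => [/H ->|_]; rewrite ?mulr0 ?mul0r//.
    * by rewrite rmorph0 mul0r.
    * by rewrite rmorph0 mulr0.
  + move=> k; rewrite /singular_component udiag_adj !(udiagM _ _ UU).
    apply: eq_udiag => j; case: ifP => [/eqP tj|_]; last by rewrite mulr0.
    have tj0 : t j != 0 by rewrite -normr_gt0 tj singular_value_gt0.
    have s2 : Num.sg (t j) ^+ 2 = 1 by rewrite sqr_sg tj0.
    apply: Cplx_eqP; rewrite ?reM ?imM re_conj im_conj /=; first by ring.
    by apply: (@eq_trans _ _ (Num.sg (t j) ^+ 2 * Num.sg (t j))); [ring|rewrite s2 mul1r].
- exact: singular_value_decr.
- exact: singular_value_gt0.
Qed.

Lemma odd_calculus (phi : R -> R) : (forall x, phi (- x) = - phi x) ->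
  g (udiag U (fun j => imag (phi (t j)))).
Proof.
move=> phiN; rewrite -(singular_sum phiN).
(* SVD-closedness only speaks of nonzero matrices. *)
have [X0|X0] := eqVneq (udiag U (fun j => imag (t j))) 0.
  have phi0 : phi 0 = 0 by have := phiN 0; rewrite oppr0; lra.
  have -> : \sum_k of_real (phi (singular_value k)) *: singular_component k = 0.
    rewrite (singular_sum phiN) -(udiag0 U); apply: eq_udiag => j.
    move: X0; rewrite -(udiag0 U) => /(udiag_inj UU) /(_ j) /(congr1 im) /= ->.
    by rewrite phi0.
  exact: (lie_zero G_subgroup).
apply: (lie_sum G_unitary G_subgroup G_closed_GL) => k; apply: lie_scale.
apply: (G_svd gX X0); exists (size S), singular_value, singular_component.
by split; [exact: singular_svd|exists k].
Qed.

End OddFunctionalCalculus.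

(** * Skew-hermitian parts of exponentials *)

Section SineMembership.
Variables (R : realType) (n : nat) (G : set 'M[Cplx R]_n).
Hypothesis G_unitary : G `<=` unitary_group R n.
Hypothesis G_svd : svd_closed_subgroup G.
Local Notation g := (lie_algebra G).

Lemma lie_odd U t (phi : R -> R) : U *m U ^t* = 1%:M ->
  (forall x, phi (- x) = - phi x) ->
  g (udiag U (fun j => imag (t j))) -> g (udiag U (fun j => imag (phi (t j)))).
Proof. by case: G_svd => *; exact: odd_calculus. Qed.

(** Its eigenvalues are [2 i sin (t j)], so this is the odd calculus for the sine. It places the
    gradient of [Re tr] at [exp X] inside [g]. *)
Lemma lie_sinh X : g X -> g (expmx X - (expmx X) ^t*).
Proof.
move=> gX; have [U [t [UU XE]]] := skew_udiag (lie_skew G_unitary gX).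
have := lie_odd UU (@sinN R); rewrite XE in gX *.
move=> /(_ t gX) /(@lie_scale R n G _ 2).
rewrite (imag_scale U 2 (fun j => sin (t j))) (expmx_udiag t UU) udiag_adj.
rewrite -scaleN1r udiagZ udiagD.
congr g; apply: eq_udiag => j; apply: Cplx_eqP;
  rewrite ?reD ?imD mulN1r ?reN ?imN ?re_conj ?im_conj /=; lra.
Qed.

End SineMembership.

(** * Surjectivity of the exponential *)

Section FrobeniusDefect.
Variables (R : realType) (n : nat).
Implicit Types A B M X : 'M[Cplx R]_n.

Lemma re_tr_mul_adj A :
  re (\tr (A *m A ^t*)) = \sum_i \sum_j (re (A i j) ^+ 2 + im (A i j) ^+ 2).
Proof.
rewrite /mxtrace re_sum; apply: eq_bigr => i _; rewrite mxE re_sum.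
by apply: eq_bigr => j _; rewrite !mxE reM re_conj im_conj mulrN opprK !expr2.
Qed.

Lemma re_tr_mul_adj_ge0 A : 0 <= re (\tr (A *m A ^t*)).
Proof.
rewrite re_tr_mul_adj; do 2!apply: sumr_ge0 => ? _.
by rewrite addr_ge0 ?sqr_ge0.
Qed.

Lemma re_im_entry_le A i j :
  re (A i j) ^+ 2 + im (A i j) ^+ 2 <= re (\tr (A *m A ^t*)).
Proof.
rewrite re_tr_mul_adj (bigD1 i)//= (bigD1 j)//= -addrA lerDl addr_ge0//.
  by apply: sumr_ge0 => ? _; rewrite addr_ge0 ?sqr_ge0.
by do 2!apply: sumr_ge0 => ? _; rewrite addr_ge0 ?sqr_ge0.
Qed.

Lemma re_tr_mul_adj_eq0 A : re (\tr (A *m A ^t*)) <= 0 -> A = 0.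
Proof.
move=> A0; apply/matrixP => i j; rewrite mxE.
have := re_im_entry_le A i j; have := sqr_ge0 (re (A i j)).
have := sqr_ge0 (im (A i j)) => H1 H2 H3.
have /eqP : re (A i j) ^+ 2 = 0 by lra.
have /eqP : im (A i j) ^+ 2 = 0 by lra.
by rewrite !sqrf_eq0 => /eqP iA /eqP rA; apply: Cplx_eqP.
Qed.

Lemma re_tr_adj A : re (\tr (A ^t*)) = re (\tr A).
Proof.
rewrite /mxtrace !re_sum; apply: eq_bigr => i _.
by rewrite !mxE re_conj.
Qed.

(** For unitary [A], half the squared Frobenius distance to 1 ([defectE]). *)
Definition defect A : R := n%:R - re (\tr A).

Lemma defectE A : unitaryP A ->
  2 * defect A = re (\tr ((A - 1%:M) *m (A - 1%:M) ^t*)).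
Proof.
move=> AU; have -> : (A - 1%:M) ^t* = A ^t* - 1%:M.
  by rewrite raddfB /= map_mxB trmx1 map_mx1.
have trB B X : re (\tr (B - X)) = re (\tr B) - re (\tr X).
  by rewrite -reB; congr re; exact: raddfB.
rewrite mulmxBl mul1mx mulmxBr mulmx1 AU !trB re_tr_adj.
rewrite mxtrace1 /defect.
have -> : re (n%:R : Cplx R) = n%:R by rewrite -of_real_nat.
ring.
Qed.

Lemma defect_ge0 A : unitaryP A -> 0 <= defect A.
Proof. by move=> /defectE; have := re_tr_mul_adj_ge0 (A - 1%:M); lra. Qed.

Lemma defect_le A : unitaryP A -> defect A <= nm (A - 1%:M) ^+ 2.
Proof.
move=> AU; have := defect_ge0 AU; have := defectE AU.
have := le_trans (ler_norm _) (re_tr_le_nm ((A - 1%:M) *m (A - 1%:M) ^t*)).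
have := nmM (A - 1%:M) ((A - 1%:M) ^t*); rewrite nm_conj expr2.
set a := re _; set b := nm (_ *m _); set c := nm _ * nm _; set d := defect A.
lra.
Qed.

Lemma defect_small (rho : R) : 0 < rho -> exists2 eta : R, 0 < eta &
  forall A, unitaryP A -> defect A < eta -> nm (A - 1%:M) < rho.
Proof.
move=> rho0; pose d := rho / (n * n * 2).+1%:R.
have d0 : 0 < d by rewrite divr_gt0// ltr0n.
exists (d ^+ 2 / 2) => [|A AU Ad]; first by rewrite divr_gt0// exprn_gt0.
apply: le_lt_trans (sum_small_lt n rho0).
apply: ler_sum => i _; apply: ler_sum => j _; rewrite -/d.
have := re_im_entry_le (A - 1%:M) i j; rewrite -(defectE AU) /abs1.
set a := re _; set b := im _ => H.
have a2 := sqr_ge0 a; have b2 := sqr_ge0 b.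
have sq_le (x : R) : x ^+ 2 <= d ^+ 2 -> `|x| <= d.
  by move=> H'; rewrite ler_norml; apply/andP; split; nra.
have A1 : a ^+ 2 <= d ^+ 2 by lra.
have B1 : b ^+ 2 <= d ^+ 2 by lra.
by have := sq_le a A1; have := sq_le b B1; lra.
Qed.

(** Families are indexed by all of [nat], only the first [k] values being multiplied: they then live
    in one product space, compact by Tychonoff when the values are in [G], and are easily
    concatenated. *)
Fixpoint prodm (f : nat -> 'M[Cplx R]_n) k : 'M[Cplx R]_n :=
  if k is k'.+1 then prodm f k' *m f k' else 1%:M.

Lemma eq_prodm (f h : nat -> 'M[Cplx R]_n) k :
  (forall i, (i < k)%N -> f i = h i) -> prodm f k = prodm h k.
Proof.
elim: k => [//|k IH] H /=; rewrite IH ?H// => i ik; apply: H.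
exact: ltnW.
Qed.

Lemma prodm_cst A k : prodm (fun=> A) k = A ^+ k.
Proof. by elim: k => [//|k IH]; rewrite exprSr /= IH. Qed.

Definition append (f h : nat -> 'M[Cplx R]_n) k i := if (i < k)%N then f i else h (i - k)%N.

Lemma prodm_append f h k l : prodm (append f h k) (k + l) = prodm f k *m prodm h l.
Proof.
elim: l => [|l IH].
  rewrite addn0 mulmx1; apply: eq_prodm => i ik; by rewrite /append ik.
by rewrite addnS /= IH /append ltnNge leq_addr /= addKn mulmxA.
Qed.

Lemma sum_append (phi : 'M[Cplx R]_n -> R) f h k l :
  \sum_(i < k + l) phi (append f h k i) = \sum_(i < k) phi (f i) + \sum_(i < l) phi (h i).
Proof.
elim: l => [|l IH].
  rewrite addn0 big_ord0 addr0; apply: eq_bigr => i _; by rewrite /append ltn_ord.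
by rewrite addnS !big_ord_recr /= IH /append ltnNge leq_addr /= addKn addrA.
Qed.

(** Inserts [E *m E'] between the factors [i] and [i + 1]; with [E *m E' = 1] this moves one vertex
    of the broken geodesic and leaves the product unchanged. *)
Definition perturb (f : nat -> 'M[Cplx R]_n) i (E E' : 'M[Cplx R]_n) j :=
  if j == i then f i *m E else if j == i.+1 then E' *m f i.+1 else f j.

Lemma perturb_lt f i E E' j : (j < i)%N -> perturb f i E E' j = f j.
Proof.
by move=> ji; rewrite /perturb ltn_eqF// ltn_eqF//; exact: ltnW.
Qed.

Lemma perturb_gt f i E E' j : (i.+1 < j)%N -> perturb f i E E' j = f j.
Proof.
by move=> ij; rewrite /perturb !gtn_eqF//; exact: ltnW.
Qed.

Lemma perturb0 f i E E' : perturb f i E E' i = f i *m E.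
Proof. by rewrite /perturb eqxx. Qed.

Lemma perturb1 f i E E' : perturb f i E E' i.+1 = E' *m f i.+1.
Proof. by rewrite /perturb gtn_eqF// eqxx. Qed.

Lemma prodm_perturb f i E E' k : E *m E' = 1%:M -> (i.+1 < k)%N ->
  prodm (perturb f i E E') k = prodm f k.
Proof.
move=> EE; elim: k => // k IH; rewrite ltnS leq_eqVlt => /orP[/eqP <-|ik] /=.
  rewrite perturb1 perturb0 (eq_prodm (@perturb_lt f i E E')).
  by rewrite !mulmxA -(mulmxA (prodm f i *m f i)) EE mulmx1.
by rewrite (IH ik) perturb_gt.
Qed.

Lemma sum_perturb (phi : 'M[Cplx R]_n -> R) f i E E' k : (i.+1 < k)%N ->
  \sum_(j < k) phi (perturb f i E E' j) = \sum_(j < k) phi (f j)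
    + (phi (f i *m E) - phi (f i)) + (phi (E' *m f i.+1) - phi (f i.+1)).
Proof.
elim: k => // k IH; rewrite ltnS leq_eqVlt => /orP[/eqP <-|ik].
  rewrite !big_ord_recr /= perturb1 perturb0.
  under eq_bigr do rewrite (perturb_lt _ _ _ (ltn_ord _)).
  ring.
rewrite !big_ord_recr /= (IH ik) perturb_gt//; ring.
Qed.

Lemma continuous_prodm k :
  continuous (fun f : prod_topology (fun _ : nat => 'M[Cplx R]_n) => prodm f k).
Proof.
elim: k => [|k IH].
  move=> f; apply: (@cvg_nmP R n _ (nbhs f) _ _ _).2 => e e0.
  by apply: nearW => h; rewrite subrr nm0.
apply: continuous_mulmx; first exact: IH.
exact: (@proj_continuous nat (fun=> 'M[Cplx R]_n) k).
Qed.

Lemma continuous_sum_re_tr k :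
  continuous (fun f : prod_topology (fun _ : nat => 'M[Cplx R]_n) =>
    \sum_(i < k) re (\tr (f i))).
Proof.
elim: k => [|k IH].
  move=> f; apply: (@cvgrPdist_lt _ _ _ (nbhs f) _ _ _).2 => e e0.
  by apply: nearW => h; rewrite !big_ord0 subrr normr0.
pose ft (f : prod_topology (fun _ : nat => 'M[Cplx R]_n)) := re (\tr (f k)).
have cft : continuous ft.
  apply: continuous_re_tr; exact: (@proj_continuous nat (fun=> 'M[Cplx R]_n) k).
have -> : (fun f : prod_topology (fun _ : nat => 'M[Cplx R]_n) =>
    \sum_(i < k.+1) re (\tr (f i))) =
  (fun f : prod_topology (fun _ : nat => 'M[Cplx R]_n) =>
    \sum_(i < k) re (\tr (f i)) + ft f).
  by apply/funext => f; rewrite big_ord_recr.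
move=> f; apply: (@cvgD _ _ _ (nbhs f)); [exact: IH|exact: cft].
Qed.

End FrobeniusDefect.

(** * Fine factorizations and the first variation *)

Lemma add_split (V : zmodType) (e a y : V) : e = a + y + (e - a - y).
Proof. by rewrite [RHS]addrC [a + y]addrC addrA !subrK. Qed.

Lemma first_variation_arith (R : realFieldType) (a b p q x y t K : R) :
  x + t * a + p + (y + (- t) * b + q) <= x + y -> - K <= p -> - K <= q ->
  t * (a - b) <= K + K.
Proof. lra. Qed.

Lemma double_diff (V : zmodType) (a a' b b' d : V) :
  a - a' = b - b' -> d + d = (a' - b' + d) - (a - b - d).
Proof.
move=> /eqP; rewrite subr_eq => /eqP ->.
have -> : b - b' + a' - b = a' - b' by rewrite addrC addrA addKr addrC.
by rewrite opprB [RHS]addrC addrA subrK.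
Qed.

Section Geodesics.
Variables (R : realType) (n : nat) (G : set 'M[Cplx R]_n).
Hypothesis G_unitary : G `<=` unitary_group R n.
Hypothesis G_connected : connected G.
Hypothesis G_svd : svd_closed_subgroup G.
Local Notation g := (lie_algebra G).
Implicit Types A B X Y Z M u : 'M[Cplx R]_n.

Let G_subgroup : subgroup_of_GL G. Proof. by case: G_svd. Qed.
Let G_closed_GL : closed_in_GL G. Proof. by case: G_svd. Qed.

(* The sum of the defects plays the role of the energy of a broken geodesic:
   cutting exp X into N equal pieces divides it by N, up to a constant. *)
Definition fine_product M := forall eta : R, 0 < eta -> exists k f,
  [/\ forall i, G (f i), prodm f k = M & \sum_(i < k) defect (f i) < eta].

Lemma fine_product_mul M N : fine_product M -> fine_product N -> fine_product (M *m N).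
Proof.
move=> HM HN eta eta0; have e20 : 0 < eta / 2 by lra.
have [k [f [Gf fM sf]]] := HM _ e20; have [l [h [Gh hN sh]]] := HN _ e20.
exists (k + l)%N, (append f h k); split.
- by move=> i; rewrite /append; case: ifP.
- by rewrite prodm_append fM hN.
- by rewrite sum_append; lra.
Qed.

Lemma fine_product_exp X : g X -> fine_product (expmx X).
Proof.
move=> gX eta eta0; pose x := nm X; have x0 : 0 <= x := nm_ge0 X.
(* [N > 2 * x] brings [X / N] into the range of the estimates near 0; the [N] defects add up to at
   most [4 * x ^+ 2 / N], and the second summand makes this less than [eta]. *)
pose N := (Num.truncn (2 * x + 4 * x ^+ 2 / eta)).+1.
have NN : 2 * x + 4 * x ^+ 2 / eta < N%:R by exact: truncnS_gt.
have xe0 : 0 <= 4 * x ^+ 2 / eta by rewrite divr_ge0 ?mulr_ge0 ?sqr_ge0// ltW.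
have N0 : (0 : R) < N%:R by rewrite ltr0n.
pose Y := of_real N%:R^-1 *: X.
have nY : nm Y = N%:R^-1 * x by rewrite nmZ ger0_norm// invr_ge0 ltW.
have Y2 : nm Y <= 1 / 2.
  by rewrite nY mulrC ler_pdivrMr//; lra.
have gE : G (expmx Y) by exact: gX.
have NV : N%:R * N%:R^-1 = 1 :> R := mulfV (lt0r_neq0 N0).
exists N, (fun=> expmx Y); split; first by move=> _; exact: gE.
  by rewrite prodm_cst (expmx_skewX _ _ (lie_skew G_unitary gX)) NV of_real1 scale1r.
rewrite sumr_const card_ord -mulr_natl.
have D := defect_le (group_unitary G_unitary gE).
have Y1 := nm_expmx_sub1 Y2.
have D2 : defect (expmx Y) <= (2 * (N%:R^-1 * x)) ^+ 2.
  rewrite -nY; apply: (le_trans D); rewrite !expr2.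
  by apply: ler_pM; rewrite ?nm_ge0.
apply: (@le_lt_trans _ _ (N%:R * (2 * (N%:R^-1 * x)) ^+ 2)).
  by rewrite ler_pM2l.
have -> : N%:R * (2 * (N%:R^-1 * x)) ^+ 2 = 4 * x ^+ 2 / N%:R :> R.
  by field; rewrite gt_eqF.
rewrite ltr_pdivrMr// [ltRHS]mulrC -ltr_pdivrMr//; lra.
Qed.

(** By local surjectivity, an element of [G] within the fixed distance [rho / C] of a fine product
    is again a fine product. The set of these is thus open and closed in the connected [G], and it
    contains 1. *)
Lemma fine_product_all M : G M -> fine_product M.
Proof.
have r0 : (0 : R) < 1 / 4 by lra.
have [rho rho0 onto] := exp_local_onto G_unitary G_subgroup G_closed_GL r0 (lexx _).
pose H := [set M | G M /\ fine_product M].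
pose C := unitary_bound R n; have C0 : 0 < C := unitary_bound_gt0 R n.
have step A B : H A -> G B -> nm (B - A) < rho / C -> H B.
  move=> [GA fA] GB BA; split => //.
  have AU := unitary_adjl (group_unitary G_unitary GA).
  have GAB : G (A ^t* *m B).
    by apply: (group_mul G_subgroup) => //; exact: group_adj.
  have near1 : nm (A ^t* *m B - 1%:M) < rho.
    rewrite -AU -mulmxBr; apply: (le_lt_trans (nmM _ _)).
    apply: (@le_lt_trans _ _ (C * nm (B - A))).
      rewrite ler_wpM2r ?nm_ge0// nm_conj.
      exact: (nm_group G_unitary).
    by rewrite mulrC -ltr_pdivlMr.
  have [X [gX _ XE]] := onto _ GAB near1.
  have -> : B = A *m expmx X.
    by rewrite XE mulmxA (group_unitary G_unitary GA) mul1mx.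
  by apply: fine_product_mul => //; exact: fine_product_exp.
have H1 : H 1%:M.
  split; first exact: (group_one G_subgroup).
  rewrite -(expmx0 R n); apply: fine_product_exp; exact: (lie_zero G_subgroup).
have HG : H = G.
  apply: G_connected.
  - by exists 1%:M.
  - exists [set B | exists2 A, H A & nm (B - A) < rho / C].
      rewrite openE => B [A HA BA]; apply/nbhs_nmP.
      exists (rho / C - nm (B - A)); first by rewrite subr_gt0.
      move=> D DB; exists A => //.
      by apply: le_lt_trans (nm_dist_triangle B D A) _; rewrite -ltrBrDr.
    apply/seteqP; split => [A HA|B [GB [A HA BA]]]; last exact: step HA GB BA.
    split; first by case: HA.
    by exists A => //; rewrite subrr nm0 divr_gt0.
  - exists (closure H); first exact: closed_closure.
    apply/seteqP; split => [A HA|B [GB clB]].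
      by split; [case: HA|exact: subset_closure].
    have [A [HA BA]] := clB _ (near_nm B (divr_gt0 rho0 C0)).
    by apply: step HA GB _; rewrite nm_distC.
by move=> GM; have [] : H M by rewrite HG.
Qed.

(** The first-order part of the hypothesis is [t * re (\tr ((A - B) *m Z))], and the two Taylor
    remainders add up to at most [4 * C * z ^+ 2 * t ^+ 2]; divide by [t > 0] and let it tend to
    0. *)
Lemma first_variation A B Z : G A -> G B -> g Z ->
  (forall t : R, re (\tr (A *m expmx (of_real t *: Z))) +
     re (\tr (expmx (of_real (- t) *: Z) *m B)) <= re (\tr A) + re (\tr B)) ->
  re (\tr ((A - B) *m Z)) <= 0.
Proof.
move=> GA GB gZ H; pose z := nm Z; have z0 : 0 <= z := nm_ge0 Z.
pose C := unitary_bound R n; have C0 : 0 < C := unitary_bound_gt0 R n.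
have d0 : 0 < 1 / (2 * (z + 1)) by rewrite divr_gt0// mulr_gt0//; lra.
apply: (@small_le0 _ _ (4 * C * z ^+ 2) (1 / (2 * (z + 1)))) => //.
  by rewrite !mulr_ge0 ?sqr_ge0// ltW.
move=> t t0; rewrite ler_pdivlMr; last by rewrite mulr_gt0//; lra.
move=> t1; have tz : t * z <= 1 / 2 by nra.
have taylor s : `|s| = t -> nm (expmx (of_real s *: Z) - 1%:M - of_real s *: Z) <= 2 * (t * z) ^+ 2.
  move=> st; have nZ : nm (of_real s *: Z) = t * z by rewrite nmZ st.
  by rewrite -nZ; apply: expmx_taylor; rewrite nZ.
have T1 := taylor t (gtr0_norm t0).
have T2 : nm (expmx (of_real (- t) *: Z) - 1%:M - of_real (- t) *: Z) <= 2 * (t * z) ^+ 2.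
  by apply: taylor; rewrite normrN gtr0_norm.
have trD (P Q : 'M[Cplx R]_n) : re (\tr (P + Q)) = re (\tr P) + re (\tr Q).
  by rewrite -reD; congr re; exact: raddfD.
have trZ a (P : 'M[Cplx R]_n) : re (\tr (of_real a *: P)) = a * re (\tr P).
  by rewrite mxtraceZ reM /= mul0r subr0.
have trB (P Q : 'M[Cplx R]_n) : re (\tr (P - Q)) = re (\tr P) - re (\tr Q).
  by rewrite -reB; congr re; exact: raddfB.
have := H t.
set E := expmx (of_real t *: Z) in T1 *; set F := expmx (of_real (- t) *: Z) in T2 *.
set P := E - 1%:M - _ in T1; set Q := F - 1%:M - _ in T2.
have AE : re (\tr (A *m E)) = re (\tr A) + t * re (\tr (A *m Z)) + re (\tr (A *m P)).
  rewrite [E in LHS](add_split E 1%:M (of_real t *: Z)) -/P.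
  by rewrite mulmxDr mulmxDr mulmx1 -scalemxAr !trD trZ.
have FB : re (\tr (F *m B)) = re (\tr B) + (- t) * re (\tr (B *m Z)) + re (\tr (Q *m B)).
  rewrite [F in LHS](add_split F 1%:M (of_real (- t) *: Z)) -/Q.
  by rewrite mulmxDl mulmxDl mul1mx -scalemxAl !trD trZ (mxtrace_mulC Z B).
have -> : re (\tr ((A - B) *m Z)) = re (\tr (A *m Z)) - re (\tr (B *m Z)).
  by rewrite mulmxBl trB.
rewrite AE FB => H'.
have HP : `|re (\tr (A *m P))| <= C * (2 * (t * z) ^+ 2).
  apply: (le_trans (re_tr_le_nm _)); apply: (le_trans (nmM _ _)).
  exact: (ler_pM (nm_ge0 A) (nm_ge0 P) (nm_group G_unitary GA) T1).
have HQ : `|re (\tr (Q *m B))| <= C * (2 * (t * z) ^+ 2).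
  apply: (le_trans (re_tr_le_nm _)); apply: (le_trans (nmM _ _)).
  by rewrite mulrC; exact: (ler_pM (nm_ge0 B) (nm_ge0 Q) (nm_group G_unitary GB) T2).
move: HP HQ; rewrite !ler_norml => /andP[HP _] /andP[HQ _].
have key := first_variation_arith H' HP HQ.
have KE : C * (2 * (t * z) ^+ 2) + C * (2 * (t * z) ^+ 2) = t * (t * (4 * C * z ^+ 2)).
  by ring.
by move: key; rewrite KE (ler_pM2l t0).
Qed.

(** The odd map [exp X - exp (- X)] is [2 X] plus a map with Lipschitz constant
    [2 * (expR (1 / 4) - 1) <= 1], which is less than 2. The radius [1 / 4] of the local logarithms
    comes from here as well. *)
Lemma sinh_inj X Y : nm X <= 1 / 4 -> nm Y <= 1 / 4 ->
  expmx X - expmx (- X) = expmx Y - expmx (- Y) -> X = Y.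
Proof.
move=> Xr Yr E; apply/eqP; rewrite -subr_eq0; apply/eqP/nm_eq0/le_anti.
rewrite nm_ge0 andbT.
have NXr : nm (- X) <= 1 / 4 by rewrite nmN.
have NYr : nm (- Y) <= 1 / 4 by rewrite nmN.
have e4 : expR (1 / 4) - 1 <= 2 * (1 / 4) :> R by apply: expR_le_2; lra.
have H1 := nm_expmx_dist Xr Yr; have H2 := nm_expmx_dist NXr NYr.
have d0 := nm_ge0 (X - Y).
have XY : - X - - Y = - (X - Y) by rewrite opprB opprK addrC.
rewrite XY nmN opprK in H2.
have := nmB (expmx (- X) - expmx (- Y) + (X - Y)) (expmx X - expmx Y - (X - Y)).
rewrite -(double_diff (X - Y) E).
have -> : X - Y + (X - Y) = of_real 2 *: (X - Y).
  by rewrite of_real_nat scaler_nat mulr2n.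
rewrite nmZ (ger0_norm (ler0n R 2)).
move: H1 H2 d0 e4; set d := nm (X - Y); set e := expR _.
set p := nm (_ - _ - _); set q := nm (_ - _ + _) => H1 H2 d0 e4 H3.
clear -H1 H2 d0 e4 H3; nra.
Qed.

End Geodesics.

(** * Minimal factorizations and surjectivity *)

Section ExponentialOnto.
Variables (R : realType) (n : nat) (G : set 'M[Cplx R]_n).
Hypothesis G_unitary : G `<=` unitary_group R n.
Hypothesis G_connected : connected G.
Hypothesis G_svd : svd_closed_subgroup G.
Local Notation g := (lie_algebra G).
Implicit Types A B X Y Z M u : 'M[Cplx R]_n.

Let G_subgroup : subgroup_of_GL G. Proof. by case: G_svd. Qed.
Let G_closed_GL : closed_in_GL G. Proof. by case: G_svd. Qed.

(** For fixed [k], maximizing the sum of the [Re tr] is minimizing the total defect. The families in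
    [G] with product [M] form a closed subset of a compact product. *)
Lemma maximal_factorization M k (f0 : nat -> 'M[Cplx R]_n) :
  (forall i, G (f0 i)) -> prodm f0 k = M ->
  exists f, [/\ forall i, G (f i), prodm f k = M &
    forall h, (forall i, G (h i)) -> prodm h k = M ->
      \sum_(i < k) re (\tr (h i)) <= \sum_(i < k) re (\tr (f i))].
Proof.
move=> Gf0 f0M.
pose P := prod_topology (fun _ : nat => 'M[Cplx R]_n).
pose KG : set P := [set f | forall i, G (f i)].
pose KM : set P := (fun f : P => prodm f k) @^-1` [set M].
have cG : compact G.
  apply: (compact_nm (r := unitary_bound R n)).
    exact: (@subgroup_is_closed R n G G_unitary G_closed_GL).
  by move=> A GA; exact: (nm_group G_unitary GA).
have cKG : compact KG by exact: (@tychonoff nat (fun=> 'M[Cplx R]_n) (fun=> G)).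
have cKM : closed KM.
  apply: preimage_closed => [f _|]; first exact: (@continuous_prodm R n k).
  apply/closed_nm => A H; apply/eqP; rewrite -subr_eq0; apply/eqP/nm_eq0/le_anti.
  rewrite nm_ge0 andbT; apply: (small_le0 ltr01 ler01) => e e0 _.
  by have [B /= -> BA] := H e e0; rewrite mulr1 nm_distC ltW.
have cK : compact (KG `&` KM) by exact: compact_closedI.
have K0 : KG `&` KM !=set0 by exists f0; split.
have [f fK fmax] := compact_EVT_max K0 cK
  (continuous_subspaceT (@continuous_sum_re_tr R n k)).
move: fK; rewrite inE => -[Gf fM]; exists f; split => // h Gh hM.
by apply: fmax; rewrite inE; split.
Qed.

Lemma group_exp_sinh A X : g X -> expmx X = A -> g (A - A ^t*).
Proof. by move=> gX <-; exact: (lie_sinh G_unitary G_svd). Qed.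

(* The first variation tested on the skew-hermitian part of f i - f (i + 1)
   shows that this part vanishes. *)
Lemma maximal_balanced M k f i X Y :
  (forall j, G (f j)) -> prodm f k = M ->
  (forall h, (forall j, G (h j)) -> prodm h k = M ->
      \sum_(j < k) re (\tr (h j)) <= \sum_(j < k) re (\tr (f j))) ->
  (i.+1 < k)%N -> g X -> expmx X = f i -> g Y -> expmx Y = f i.+1 ->
  f i - (f i) ^t* = f i.+1 - (f i.+1) ^t*.
Proof.
move=> Gf fM fmax ik gX XE gY YE.
pose D := f i - f i.+1; pose W := D - D ^t*.
have WE : W = (f i - (f i) ^t*) - (f i.+1 - (f i.+1) ^t*).
  rewrite /W /D (_ : (f i - f i.+1) ^t* = (f i) ^t* - (f i.+1) ^t*).
    by rewrite !opprD !opprK addrACA.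
  by rewrite raddfB /= map_mxB.
have gW : g W.
  rewrite WE; apply: (lie_sub G_unitary G_subgroup G_closed_GL).
    exact: group_exp_sinh gX XE.
  exact: group_exp_sinh gY YE.
have var t : re (\tr (f i *m expmx (of_real t *: - W))) +
    re (\tr (expmx (of_real (- t) *: - W) *m f i.+1)) <=
    re (\tr (f i)) + re (\tr (f i.+1)).
  have gNW := lie_opp gW.
  pose E := expmx (of_real t *: - W); pose E' := expmx (of_real (- t) *: - W).
  have EE : E *m E' = 1%:M.
    rewrite (expmx_skewD _ _ (lie_skew G_unitary gNW)) subrr of_real0 scale0r.
    exact: expmx0.
  have Gh j : G (perturb f i E E' j).
    rewrite /perturb; case: ifP => _; last case: ifP => _; last exact: Gf.
      by apply: (group_mul G_subgroup); [exact: Gf|exact: gNW].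
    by apply: (group_mul G_subgroup); [exact: gNW|exact: Gf].
  have := fmax _ Gh (etrans (prodm_perturb f EE ik) fM).
  rewrite (sum_perturb (fun A => re (\tr A)) f E E' ik) -/E -/E'; lra.
have := first_variation G_unitary (Gf i) (Gf i.+1) (lie_opp gW) var.
have trN (P : 'M[Cplx R]_n) : re (\tr (- P)) = - re (\tr P).
  by rewrite -reN; congr re; exact: raddfN.
have trB (P Q : 'M[Cplx R]_n) : re (\tr (P - Q)) = re (\tr P) - re (\tr Q).
  by rewrite -reB; congr re; exact: raddfB.
have Wadj : W ^t* = - W := lie_skew G_unitary gW.
have DW : re (\tr (D *m W)) = - re (\tr (D ^t* *m W)).
  by rewrite -re_tr_adj adjM Wadj mulNmx trN mxtrace_mulC.
(* The direction [Z = - W] was chosen for this sign: the first variation gives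
   [re (\tr (D *m W)) >= 0], which forces the squared norm of [W] to be at most 0. *)
have WW : re (\tr (W *m W ^t*)) = - (2 * re (\tr (D *m W))).
  by rewrite Wadj mulmxN trN {1}/W mulmxBl trB DW; lra.
rewrite -/D mulmxN trN => D0.
have W0 : W = 0 by apply: re_tr_mul_adj_eq0; rewrite WW; lra.
by apply/eqP; rewrite -subr_eq0 -WE W0.
Qed.

Lemma expmx_onto M : G M -> exists2 X, g X & expmx X = M.
Proof.
move=> GM; have r0 : (0 : R) < 1 / 4 by lra.
have [rho rho0 onto] := exp_local_onto G_unitary G_subgroup G_closed_GL r0 (lexx _).
have [eta eta0 small] := defect_small n rho0.
have [k [f0 [Gf0 f0M sf0]]] := fine_product_all G_unitary G_connected G_svd GM eta0.
have [f [Gf fM fmax]] := maximal_factorization Gf0 f0M.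
have sum_defect (h : nat -> 'M[Cplx R]_n) : \sum_(i < k) defect (h i) =
    n%:R *+ k - \sum_(i < k) re (\tr (h i)).
  by rewrite /defect sumrB sumr_const card_ord.
(* The smallness of the fine product [f0] passes to the optimal [f], so each [f i] stays where local
   logarithms exist. *)
have sf : \sum_(i < k) defect (f i) < eta.
  by move: sf0; rewrite !sum_defect; have := fmax _ Gf0 f0M; lra.
have near1 i : (i < k)%N -> exists X, [/\ g X, nm X <= 1 / 4 & expmx X = f i].
  move=> ik; apply: onto; first exact: Gf.
  apply: small; first exact: (group_unitary G_unitary (Gf i)).
  apply: le_lt_trans sf; rewrite (bigD1 (Ordinal ik))//= lerDl.
  apply: sumr_ge0 => j _; exact: defect_ge0 (group_unitary G_unitary (Gf j)).
have step i : (i.+1 < k)%N -> f i.+1 = f i.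
  move=> ik; have [X [gX X4 XE]] := near1 i (ltnW ik).
  have [Y [gY Y4 YE]] := near1 i.+1 ik.
  have bal := maximal_balanced Gf fM fmax ik gX XE gY YE.
  have aX : expmx (- X) = (f i) ^t* by rewrite -(lie_exp_adj G_unitary gX) XE.
  have aY : expmx (- Y) = (f i.+1) ^t* by rewrite -(lie_exp_adj G_unitary gY) YE.
  have E : expmx X - expmx (- X) = expmx Y - expmx (- Y).
    by rewrite aX aY XE YE {aX aY XE YE}.
  have XY := sinh_inj X4 Y4 E.
  rewrite -YE -XY; exact: XE.
have all_eq i : (i < k)%N -> f i = f 0%N.
  elim: i => [//|i IH] ik; rewrite (step _ ik); exact: IH (ltnW ik).
(* The empty product: [M] is the identity. *)
have [k0|k0] := posnP k.
  exists 0; first exact: (lie_zero G_subgroup).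
  by rewrite expmx0 -fM k0.
have [X [gX _ XE]] := near1 0%N k0.
exists (of_real k%:R *: X); first exact: lie_scale.
have skX := lie_skew G_unitary gX.
have := expmx_skewX 1 k skX; rewrite mulr1 of_real1 scale1r => <-.
by rewrite XE -prodm_cst -fM; apply: eq_prodm => i /all_eq.
Qed.

End ExponentialOnto.

(** * Principal logarithms *)

Section PrincipalAngle.
Variable R : realType.
Implicit Types x y : R.

Lemma acos_cos_itv x : 0 <= acos (cos x) <= pi.
Proof. by rewrite acos_ge0 ?acos_lepi ?cos_geN1 ?cos_le1. Qed.

Lemma cos_acos_cos x : cos (acos (cos x)) = cos x.
Proof. by apply: acosK; rewrite in_itv /= cos_geN1 cos_le1. Qed.

Lemma acos_cos_abs x : `|x| <= pi -> acos (cos x) = `|x|.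
Proof.
by move=> xpi; rewrite -cos_norm cosK// in_itv /= normr_ge0.
Qed.

(** [acos (cos x)] is the distance from [x] to the multiples of [2 pi]. The form [?= iff] keeps the
    equality case, which sums over the eigenvalues along with the inequality. *)
Lemma sqr_acos_cos_le x :
  acos (cos x) ^+ 2 <= x ^+ 2 ?= iff (`|x| <= pi).
Proof.
have /andP[a0 api] := acos_cos_itv x; rewrite -(real_normK (num_real x)).
have [xpi|xpi] := leP `|x| pi; first by rewrite acos_cos_abs//; split; rewrite ?eqxx.
have lt_ax : acos (cos x) < `|x| := le_lt_trans api xpi.
have sqr_lt : acos (cos x) ^+ 2 < `|x| ^+ 2 by rewrite !expr2; nra.
by split; [exact: ltW|rewrite lt_eqF].
Qed.

(* The odd representative of x modulo 2 pi in [-pi, pi]: at odd multiples of pi,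
   where both endpoints qualify, the sign of x decides. *)
Definition principal_angle x : R :=
  (if sin x == 0 then Num.sg x else Num.sg (sin x)) * acos (cos x).

Lemma principal_angleN x : principal_angle (- x) = - principal_angle x.
Proof.
rewrite /principal_angle sinN cosN oppr_eq0 -mulNr.
by case: ifP => _; rewrite sgrN.
Qed.

Lemma norm_principal_angle x : `|principal_angle x| <= pi.
Proof.
have /andP[a0 api] := acos_cos_itv x; rewrite normrM (ger0_norm a0).
apply: le_trans api; rewrite ler_piMl//.
by case: ifP => _; rewrite normr_sg lern1 leq_b1.
Qed.

Lemma cis_principal_angle x : cis (principal_angle x) = cis x.
Proof.
have sa : sin (acos (cos x)) = `|sin x|.
  by rewrite sin_acos ?cos_geN1 ?cos_le1// -sin2cos2 sqrtr_sqr.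
rewrite /principal_angle; case: (eqVneq (sin x) 0) => [s0|s0].
  have [x0|x0|->] := ltgtP x 0.
  - by rewrite ltr0_sg// mulN1r; apply: Cplx_eqP; rewrite /=
      ?cosN ?sinN ?cos_acos_cos ?sa ?s0 ?normr0 ?oppr0.
  - by rewrite gtr0_sg// mul1r; apply: Cplx_eqP; rewrite /= ?cos_acos_cos ?sa ?s0 ?normr0.
  - by rewrite sgr0 mul0r.
have [y0|y0|y0] := ltgtP (sin x) 0; last by rewrite y0 eqxx in s0.
- rewrite ltr0_sg// mulN1r; apply: Cplx_eqP; rewrite /= ?cosN ?sinN ?cos_acos_cos//.
  by rewrite sa ltr0_norm// opprK.
- rewrite gtr0_sg// mul1r; apply: Cplx_eqP; rewrite /= ?cos_acos_cos//.
  by rewrite sa gtr0_norm.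
Qed.

(** The cosines give [|x| = |y|]; opposite signs would make a sine vanish strictly between 0 and
    [pi]. *)
Lemma cis_inj x y : `|x| < pi -> `|y| < pi -> cis x = cis y -> x = y.
Proof.
move=> xpi ypi E; have [cE sE] : cos x = cos y /\ sin x = sin y.
  by split; [exact: (congr1 re E)|exact: (congr1 im E)].
have nE : `|x| = `|y|.
  by rewrite -(acos_cos_abs (ltW xpi)) -(acos_cos_abs (ltW ypi)) cE.
have sin_neq0 (z : R) : 0 < z -> z < pi -> sin z <> 0.
  by move=> z0 zpi; apply/eqP; rewrite gt_eqF// sin_gt0_pi// z0 zpi.
have [x0|x0] := leP 0 x; have [y0|y0] := leP 0 y.
- by move: nE; rewrite !ger0_norm.
- move: nE xpi ypi; rewrite (ger0_norm x0) (ltr0_norm y0) => xE xpi ypi.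
  have x1 : 0 < x by rewrite xE oppr_gt0.
  case: (sin_neq0 x x1 xpi); have yE : y = - x by rewrite xE opprK.
  by move: sE; rewrite yE sinN; lra.
- move: nE xpi ypi; rewrite (ltr0_norm x0) (ger0_norm y0) => xE xpi ypi.
  have y1 : 0 < y by rewrite -xE oppr_gt0.
  by case: (sin_neq0 y y1 ypi); move: sE; rewrite -xE sinN; lra.
- by move: nE; rewrite !ltr0_norm// => /oppr_inj.
Qed.

Lemma cis_eqN1 x : `|x| = pi -> cis x = -1.
Proof.
move=> xpi; have cx : cos x = -1 by rewrite -cos_norm xpi cospi.
apply: Cplx_eqP; rewrite ?reN ?imN /= ?oppr0//.
by apply/eqP; rewrite -norm_cos_eq1 cx normrN normr1.
Qed.

End PrincipalAngle.

(** * Norms and uniqueness of principal logarithms *)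

Section SkewNorm.
Variables (R : realType) (n : nat).
Implicit Types (U V : 'M[Cplx R]_n) (t s : 'I_n -> R).

Lemma frobenius_norm_udiag U t : U *m U ^t* = 1%:M ->
  frobenius_norm (udiag U (fun j => imag (t j))) = Num.sqrt (\sum_j t j ^+ 2).
Proof.
move=> UU; rewrite /frobenius_norm udiag_adj (udiagM _ _ UU); congr (Num.sqrt _).
set d := fun j => _.
have -> : \tr (udiag U d) = \tr (U *m udiag U d *m U ^t*).
  by rewrite -mulmxA (mxtrace_mulC U) -mulmxA (unitary_adjl UU) mulmx1.
rewrite (udiagK _ UU) mxtrace_diag re_sum; apply: eq_bigr => j _.
by rewrite mxE /d reM re_conj im_conj /=; ring.
Qed.

(* Both sides are symmetric functions of the roots of the same characteristic
   polynomial. *)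
Lemma sum_udiag_eq U V (f h : 'I_n -> Cplx R) (phi : Cplx R -> R) :
  U *m U ^t* = 1%:M -> V *m V ^t* = 1%:M -> udiag U f = udiag V h ->
  \sum_j phi (f j) = \sum_j phi (h j).
Proof.
move=> UU VV E; have := char_poly_udiag f UU.
rewrite E (char_poly_udiag h VV) => P.
have : perm_eq [seq f j | j <- index_enum 'I_n] [seq h j | j <- index_enum 'I_n].
  by apply: prod_XsubC_eq; rewrite !big_map.
move=> fh.
have : \sum_(x <- [seq f j | j <- index_enum 'I_n]) phi x =
    \sum_(x <- [seq h j | j <- index_enum 'I_n]) phi x by exact: perm_big.
by rewrite !big_map.
Qed.

(** With [W = U *m V ^t*], equality of the two exponentials says that [W i j = 0] unless
    [cis (t i) = cis (s j)], hence unless [t i = s j]; this in turn gives equality of the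
    logarithms. No matching of eigenvalues or eigenspaces is required. *)
Lemma udiag_cis_inj U V t s : U *m U ^t* = 1%:M -> V *m V ^t* = 1%:M ->
  (forall j, `|t j| < pi) -> (forall j, `|s j| < pi) ->
  udiag U (fun j => cis (t j)) = udiag V (fun j => cis (s j)) ->
  udiag U (fun j => imag (t j)) = udiag V (fun j => imag (s j)).
Proof.
move=> UU VV tpi spi E; pose W := U *m V ^t*.
have entry (f h : 'I_n -> Cplx R) i j :
    (U *m (udiag U f - udiag V h) *m V ^t*) i j = (f i - h j) * W i j.
  rewrite mulmxBr mulmxBl (mul_udiag f UU).
  have -> : U *m udiag V h *m V ^t* = W *m diag_mx (\row_j h j).
    by rewrite -mulmxA (udiag_mul h VV) /W mulmxA.
  by rewrite -mulmxA -/W mxE mul_diag_mx mxE mul_mx_diag !mxE mulrBl [h j * _]mulrC.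
apply/eqP; rewrite -subr_eq0; apply/eqP.
suff H : U *m (udiag U (fun j => imag (t j)) - udiag V (fun j => imag (s j))) *m V ^t* = 0.
  move: H => /(congr1 (fun A => U ^t* *m A *m V)); rewrite mulmx0 mul0mx.
  rewrite !mulmxA (unitary_adjl UU) mul1mx -mulmxA (unitary_adjl VV) mulmx1.
  exact.
apply/matrixP => i j; rewrite entry [RHS]mxE.
have /matrixP /(_ i j) : U *m (udiag U (fun j => cis (t j)) -
    udiag V (fun j => cis (s j))) *m V ^t* = 0 by rewrite E subrr mulmx0 mul0mx.
rewrite entry [RHS]mxE => /eqP; rewrite mulf_eq0 subr_eq0 => /orP[/eqP|/eqP ->].
  by move=> /(cis_inj (tpi i) (spi j)) ->; rewrite subrr mul0r.
by rewrite mulr0.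
Qed.

Lemma plog_bound U t : U *m U ^t* = 1%:M ->
  (forall a : Cplx R, eigenvalue (udiag U (fun j => imag (t j))) a ->
     - pi <= im_part a <= pi) <-> (forall j, `|t j| <= pi).
Proof.
move=> UU; split=> [H j|H a /(eigenvalue_udiag _ _ UU) [j ->]].
  rewrite ler_norml; apply: (H (imag (t j))).
  by apply/(eigenvalue_udiag _ _ UU); exists j.
by have := H j; rewrite ler_norml.
Qed.

End SkewNorm.

Theorem proposition5p5 (R : realType) (n : nat) (G : set 'M[Cplx R]_n)
    (G_unitary : G `<=` unitary_group R n)
    (G_connected : connected G)
    (G_svd_closed : svd_closed_subgroup G) :
  (forall M, G M ->
     plog (lie_algebra G) M !=set0 /\
     (~~ eigenvalue M (-1) ->
        exists L, plog (lie_algebra G) M = [set L])) /\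
  (forall M Y, G M -> plog (lie_algebra G) M Y ->
     forall X, lie_algebra G X -> expmx X = M ->
       frobenius_norm Y <= frobenius_norm X /\
       (frobenius_norm Y = frobenius_norm X <-> plog (lie_algebra G) M X)).
Proof.
have spectral X : lie_algebra G X -> exists U t,
    U *m U ^t* = 1%:M /\ X = udiag U (fun j => imag (t j)).
  by move=> gX; exact: skew_udiag (lie_skew G_unitary gX).
have plogP M U t : U *m U ^t* = 1%:M ->
    plog (lie_algebra G) M (udiag U (fun j => imag (t j))) <->
    [/\ lie_algebra G (udiag U (fun j => imag (t j))),
        udiag U (fun j => cis (t j)) = M & forall j, `|t j| <= pi].
  move=> UU; split=> -[gX XM Xpi].
    by split; [|rewrite -(expmx_udiag t UU)|apply/(plog_bound _ UU)].
  by split; [|rewrite (expmx_udiag t UU)|apply/(plog_bound _ UU)].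
split=> [M GM|M Y GM YM X gX XM].
  have [X gX XM] := expmx_onto G_unitary G_connected G_svd_closed GM.
  have [U [t [UU XE]]] := spectral X gX.
  have nonempty : plog (lie_algebra G) M !=set0.
    exists (udiag U (fun j => imag (principal_angle (t j)))).
    apply/(plogP M U (fun j => principal_angle (t j)) UU); split.
    - rewrite XE in gX.
      exact: (lie_odd G_unitary G_svd_closed UU (@principal_angleN R) gX).
    - rewrite -XM XE (expmx_udiag t UU).
      by apply: eq_udiag => j; exact: cis_principal_angle.
    - by move=> j; exact: norm_principal_angle.
  split=> // M1; case: (nonempty) => L HL; exists L.
  (* An angle of absolute value [pi] would make -1 an eigenvalue of [M]; without one the bounds are
     strict and [udiag_cis_inj] applies. *)
  have strict V s : V *m V ^t* = 1%:M ->
      plog (lie_algebra G) M (udiag V (fun j => imag (s j))) ->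
      udiag V (fun j => cis (s j)) = M /\ forall j, `|s j| < pi.
    move=> VV /(plogP _ _ _ VV) [_ VM spi]; split=> // j.
    rewrite lt_neqAle spi andbT; apply: contraNneq M1 => sj.
    rewrite -VM; apply/(eigenvalue_udiag _ _ VV); exists j.
    by rewrite cis_eqN1.
  apply/seteqP; split=> [L' HL'|_ ->]; last exact: HL.
  have [V [s [VV LE]]] : exists V s, V *m V ^t* = 1%:M /\ L = udiag V (fun j => imag (s j)).
    by apply: spectral; case: HL.
  have [V' [s' [VV' LE']]] : exists V s, V *m V ^t* = 1%:M /\ L' = udiag V (fun j => imag (s j)).
    by apply: spectral; case: HL'.
  rewrite LE in HL; rewrite LE' in HL'.
  have [E spi] := strict V s VV HL; have [E' spi'] := strict V' s' VV' HL'.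
  rewrite /= LE LE'; apply: (udiag_cis_inj VV' VV spi' spi).
  by rewrite E E'.
have [U [t [UU XE]]] := spectral X gX.
have [V [s [VV YE]]] : exists V s, V *m V ^t* = 1%:M /\ Y = udiag V (fun j => imag (s j)).
  by apply: spectral; case: YM.
rewrite YE in YM; have [_ VM spi] := (plogP M V s VV).1 YM.
have UM : udiag U (fun j => cis (t j)) = M by rewrite -XM XE (expmx_udiag t UU).
(* [X] and [Y] may be diagonalized by different unitary matrices. Both sums are the sum of
   [acos (re z) ^+ 2] over the eigenvalues [z] of [M], so they agree although the [s j] and [t j]
   are not paired. *)
have sumE : \sum_j s j ^+ 2 = \sum_j acos (cos (t j)) ^+ 2.
  transitivity (\sum_j acos (cos (s j)) ^+ 2).
    by apply: eq_bigr => j _; rewrite (acos_cos_abs (spi j)) real_normK ?num_real.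
  have E : udiag V (fun j => cis (s j)) = udiag U (fun j => cis (t j)).
    by rewrite VM UM.
  exact: (sum_udiag_eq (fun z => acos (re z) ^+ 2) VV UU E).
have leif_sum : \sum_j s j ^+ 2 <= \sum_j t j ^+ 2 ?= iff [forall j, `|t j| <= pi].
  by rewrite sumE; apply: leif_sum => j _; exact: sqr_acos_cos_le.
have s0 : 0 <= \sum_j s j ^+ 2 by apply: sumr_ge0 => j _; exact: sqr_ge0.
have t0 : 0 <= \sum_j t j ^+ 2 by apply: sumr_ge0 => j _; exact: sqr_ge0.
rewrite YE XE (frobenius_norm_udiag s VV) (frobenius_norm_udiag t UU).
split; first by rewrite ler_wsqrtr// leif_sum.
split=> [/eqP|].
  rewrite (eqr_sqrt s0 t0) leif_sum => /forallP tpi.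
  apply/(plogP M U t UU); split; [by rewrite -XE|exact: UM|exact: tpi].
move=> /(plogP M U t UU) [_ _ tpi]; apply/eqP; rewrite (eqr_sqrt s0 t0) leif_sum.
exact/forallP.
Qed.
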